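(* Let $\mu,\nu,\sigma\in\mathcal{M}^{\infty}(G)$, let $a,b\in\mathbb{C}$, and let $\mathcal{A}$ be an arbitrary van Hove sequence in $G$. Then: (a) There exists a subsequence $\mathcal{B}$ of $\mathcal{A}$ such that $[\mu,\nu]_{\mathcal{B}}$ exists. (b) There exists a subsequence $\mathcal{B}$ of $\mathcal{A}$ such that $\mu\circledast_{\mathcal{B}}\nu$ exists. (c) There exists a subsequence $\mathcal{B}$ of $\mathcal{A}$ such that $[a\mu+b\nu,\sigma]_{\mathcal{B}}$, $[\mu,\sigma]_{\mathcal{B}}$ and $[\nu,\sigma]_{\mathcal{B}}$ exist. Moreover, for every subsequence $\mathcal B$ of $\mathcal A$ for which these twisted Eberlein convolutions exist, $[a\mu+b\nu,\sigma]_{\mathcal{B}}=a[\mu,\sigma]_{\mathcal{B}}+b[\nu,\sigma]_{\mathcal{B}}$. (d) There exists a subsequence $\mathcal{B}$ of $\mathcal{A}$ such that $[\mu,a\nu+b\sigma]_{\mathcal{B}}$, $[\mu,\nu]_{\mathcal{B}}$ and $[\mu,\sigma]_{\mathcal{B}}$ exist. Moreover, for every subsequence $\mathcal B$ of $\mathcal A$ for which these twisted Eberlein convolutions exist, $[\mu,a\nu+b\sigma]_{\mathcal{B}}=\bar a[\mu,\nu]_{\mathcal{B}}+\bar b[\mu,\sigma]_{\mathcal{B}}$. (e) There exists a subsequence $\mathcal{B}$ of $\mathcal{A}$ such that $(a\mu+b\nu)\circledast_{\mathcal{B}}\sigma$, $\mu\circledast_{\mathcal{B}}\sigma$ and $\nu\circledast_{\mathcal{B}}\sigma$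 exist. Moreover, for every subsequence $\mathcal B$ of $\mathcal A$ for which these Eberlein convolutions exist, $(a\mu+b\nu)\circledast_{\mathcal{B}}\sigma=a(\mu\circledast_{\mathcal{B}}\sigma)+b(\nu\circledast_{\mathcal{B}}\sigma)$. (f) There exists a subsequence $\mathcal{B}$ of $\mathcal{A}$ such that $\mu\circledast_{\mathcal{B}}(a\nu+b\sigma)$, $\mu\circledast_{\mathcal{B}}\nu$ and $\mu\circledast_{\mathcal{B}}\sigma$ exist. Moreover, for every subsequence $\mathcal B$ of $\mathcal A$ for which these Eberlein convolutions exist, $\mu\circledast_{\mathcal{B}}(a\nu+b\sigma)=a(\mu\circledast_{\mathcal{B}}\nu)+b(\mu\circledast_{\mathcal{B}}\sigma)$.
   Context: $G$ is a second countable, locally compact (Hausdorff) Abelian group with Haar measure $|\cdot|$. A van Hove sequence is a sequence $\mathcal A=(A_n)_{n\in\mathbb N}$ of precompact open subsets of $G$ (of positive measure) such that $\lim_{n}|\partial^K A_n|/|A_n|=0$ for each compact $K\subseteq G$, where for open $A$, $\partial^K A:=(\overline{A+K}\setminus A)\cup(((G\setminus A)-K)\cap\overline A)$. A measure on $G$ is a linear functional on $C_c(G)$ (continuous compactly supported functions $G\to\mathbb C$) such that for every compact $K$ there is $c_K>0$ with $|\mu(\varphi)|\le c_K\|\varphi\|_\infty$ whenever $\operatorname{supp}\varphi\subseteq K$ (a complex Radon measure); $|\mu|$ denotes its variation measure. $\mathcal M^\infty(G)$ is the set of translation bounded measures, i.e. those with $\sup_{t\in G}|\mu|(t+K)<\infty$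 for every compact $K$ (with non-empty interior). For $g$ on $G$ put $\widetilde g(x)=\overline{g(-x)}$, and for a measure $\widetilde\mu(g)=\overline{\mu(\widetilde g)}$. For measures $\mu,\nu$, the Eberlein convolution with respect to $\mathcal A$ is $\mu\circledast_{\mathcal A}\nu:=\lim_{n\to\infty}\frac1{|A_n|}(\mu|_{A_n})*(\nu|_{-A_n})$, said to exist (be well defined) if this limit exists in the vague topology; here $\mu|_A$ is the restriction of $\mu$ to $A$. The twisted Eberlein convolution is $[\mu,\nu]_{\mathcal A}:=\mu\circledast_{\mathcal A}\widetilde\nu$, whenever this exists. *)

(* Defs.v *)
From HB Require Import structures.
From mathcomp Require Import all_boot all_order all_algebra.
From mathcomp Require Import all_classical all_reals all_analysis.
From mathcomp Require Import complex.
Set Implicit Arguments.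
Unset Strict Implicit.
Unset Printing Implicit Defensive.
Import Order.TTheory GRing.Theory Num.Theory numFieldNormedType.Exports.
Import Normc.
Local Open Scope classical_set_scope.
Local Open Scope ring_scope.

(* The cast to [zmodType] supplies the base point [0] that the library requires
   of a measurable space. *)
Definition borel (G : topologicalZmodType) :=
  g_sigma_algebraType (@open G : set (set (G : zmodType))).

(* A nonzero translation invariant Radon measure. *)
Record is_haar (R : realType) (G : topologicalZmodType)
    (m : {measure set (borel G) -> \bar R}) : Prop := IsHaar {
  haar_neq0 : m setT != 0%E ;
  haar_invariant : forall (t : G) (B : set (borel G)),
    measurable B -> m [set t + x | x in (B : set G)] = m B ;
  haar_compact : forall K : set G, compact K -> (m K < +oo)%E ;
  haar_outer_regular : forall B : set (borel G), measurable B ->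
    m B = ereal_inf [set m U | U in [set U : set G | open U /\ B `<=` U]] ;
  haar_inner_regular : forall U : set G, open U ->
    m U = ereal_sup [set m K | K in [set K : set G | compact K /\ K `<=` U]] }.

Definition van_hove_boundary (G : topologicalZmodType) (K A : set G) : set G :=
  (closure [set x + y | x in A & y in K] `\` A) `|`
  ([set x - y | x in ~` A & y in K] `&` closure A).

Record van_hove (R : realType) (G : topologicalZmodType)
    (m : {measure set (borel G) -> \bar R}) (A : nat -> set G) : Prop :=
  VanHove {
  van_hove_open : forall n, open (A n) ;
  van_hove_precompact : forall n, precompact (A n) ;
  van_hove_gt0 : forall n, (0 < m (A n))%E ;
  van_hove_lim : forall K : set G, compact K ->
    (m (van_hove_boundary K (A n)) / m (A n))%E @[n --> \oo] --> 0%E }.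

Definition subsequence (T : Type) (B A : nat -> T) : Prop :=
  exists2 s : nat -> nat, {homo s : i j / (i < j)%N} & B = A \o s.

Section test_functions.
Context (R : realType) (G : topologicalZmodType).
Local Notation C := (R[i]^o).

Definition supp (f : G -> C) : set G := closure [set x | f x != 0].

Definition Cc_pred : {pred G -> C} :=
  fun f => `[< continuous f /\ compact (supp f) >].

Record Cc : Type := MkCc { Cc_fun :> G -> C ; _ : Cc_fun \in Cc_pred }.

HB.instance Definition _ := [isSub for Cc_fun].
HB.instance Definition _ := [Choice of Cc by <:].

Lemma Cc_predP (f : G -> C) :
  (f \in Cc_pred) <-> continuous f /\ compact (supp f).
Proof. by split=> [/asboolP|h]; last exact/asboolP. Qed.

Lemma Cc_submod_closed : submod_closed Cc_pred.
Proof.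
split=> [|a f g /Cc_predP[cf kf] /Cc_predP[cg kg]]; apply/Cc_predP; split.
- by move=> x; exact: cvg_cst.
- rewrite /supp (_ : [set x | _] = set0) ?closure0; first exact: compact0.
  by apply/seteqP; split => x //=; rewrite eqxx.
- by move=> x; apply: cvgD; [apply: cvgZr; exact: cf|exact: cg].
- rewrite /supp; apply: subclosed_compact (compactU kf kg) _.
    exact: closed_closure.
  rewrite /supp -closureU; apply: closureS => x /=.
  rewrite /GRing.add/= /GRing.scale/=.
  have [->|] := eqVneq (f x) 0; last by left.
  by rewrite scaler0 add0r; right.
Qed.

HB.instance Definition _ := GRing.isSubmodClosed.Build _ _ Cc_pred
  Cc_submod_closed.
HB.instance Definition _ := [SubChoice_isSubLmodule of Cc by <:].

Definition supnorm (f : G -> C) : R := sup (range (fun x => normc (f x))).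

Lemma supnorm_ge0 (f : G -> C) : 0 <= supnorm f.
Proof.
rewrite /supnorm.
have [[_ ub]|] := pselect (has_sup (range (fun x => normc (f x)))).
  apply: le_trans (ub_le_sup ub _); last by exists 0.
  by rewrite /=; case: (f 0) => ? ?; rewrite sqrtr_ge0.
by move/sup_out => ->.
Qed.

End test_functions.

Section complex_measures.
Context (R : realType) (G : topologicalZmodType).
Local Notation C := (R[i]^o).
Local Notation Cc := (Cc R G).

Definition cmeasure_pred : {pred Cc -> C} := fun F =>
  `[< linear F /\
      forall K : set G, compact K -> exists2 c : R, 0 < c &
        forall f : Cc, supp f `<=` K -> normc (F f) <= c * supnorm f >].

Record cmeasure : Type :=
  MkCmeasure { cmeasure_fun :> Cc -> C ; _ : cmeasure_fun \in cmeasure_pred }.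

HB.instance Definition _ := [isSub for cmeasure_fun].
HB.instance Definition _ := [Choice of cmeasure by <:].

Lemma cmeasure_submod_closed : submod_closed cmeasure_pred.
Proof.
split=> [|a F H /asboolP[lF bF] /asboolP[lH bH]]; apply/asboolP; split.
- by move=> k u v; rewrite scaler0 addr0.
- move=> K kK; exists 1 => // f _; by rewrite normc0 mul1r supnorm_ge0.
- move=> k u v; have Fuv : F (k *: u + v) = k * F u + F v := lF k u v.
  have Huv : H (k *: u + v) = k * H u + H v := lH k u v.
  change (a * F (k *: u + v) + H (k *: u + v) =
    k * (a * F u + H u) + (a * F v + H v)).
  by rewrite Fuv Huv !mulrDr !mulrA [a * k]mulrC addrACA.
- move=> K kK; have [c c0 cP] := bF K kK; have [d d0 dP] := bH K kK.
  have na : 0 <= normc a by case: (a) => ? ?; rewrite sqrtr_ge0.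
  exists (normc a * c + d) => [|f fK].
    exact: ltr_wpDl (mulr_ge0 na (ltW c0)) d0.
  rewrite mulrDl (le_trans (le_normcD _ _))// lerD ?dP//.
  by rewrite normcM -mulrA ler_wpM2l ?cP.
Qed.

HB.instance Definition _ := GRing.isSubmodClosed.Build _ _ cmeasure_pred
  cmeasure_submod_closed.
HB.instance Definition _ := [SubChoice_isSubLmodule of cmeasure by <:].

(* The measure whose functional is [F]; junk value [0] when [F] is not one.
   Restrictions to open sets, and convolutions of such restrictions when these
   sets are moreover precompact, are never junk. *)
Definition to_cmeasure (F : Cc -> C) : cmeasure := insubd (0 : cmeasure) F.

(* [var_sup mu f] is |mu|(f) for a nonnegative test function [f], hence
   [var_sup mu h] is the supremum of |mu|(f) over the test functions
   0 <= f <= h, i.e. the value at [h] of the Radon measure |mu|, when [h >= 0]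
   is lower semicontinuous. The upper integral for |mu| of any [f >= 0] is then
   an infimum over lower semicontinuous majorants (Bourbaki, Integration IV). *)
Definition var_sup (mu : cmeasure) (h : G -> \bar R) : \bar R :=
  ereal_sup [set (normc (mu g))%:E |
    g in [set g : Cc | forall x, ((normc (g x))%:E <= h x)%E]].

Definition upper_integral (mu : cmeasure) (f : G -> \bar R) : \bar R :=
  ereal_inf [set var_sup mu h |
    h in [set h | lower_semicontinuous h /\ forall x, (f x <= h x)%E]].

Definition variation (mu : cmeasure) (B : set G) : \bar R :=
  upper_integral mu (fun x => (\1_B x)%:E).

(* L^1(|mu|) is the closure of the test functions in the seminorm
   f |-> |mu|^*(|f|), and the integral extends [mu] to it by continuity. *)
Definition has_integral (mu : cmeasure) (f : G -> C) (z : C) : Prop :=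
  exists u : nat -> Cc,
    upper_integral mu (fun x => (normc (f x - u n x))%:E) @[n --> \oo] --> 0%E
    /\ mu (u n) @[n --> \oo] --> z.

Definition integral (mu : cmeasure) (f : G -> C) : C :=
  xget 0 [set z | has_integral mu f z].

Definition translation_bounded (mu : cmeasure) : Prop :=
  forall K : set G, compact K ->
    (ereal_sup (range (fun t : G => variation mu [set (t + x)%R | x in K]))
       < +oo)%E.

Definition restriction (mu : cmeasure) (A : set G) : cmeasure :=
  to_cmeasure (fun f => integral mu (fun x => \1_A x * f x)).

(* Meant for compactly supported measures, where the inner integral is again a
   test function of [x]. *)
Definition convolution (mu nu : cmeasure) : cmeasure :=
  to_cmeasure (fun f =>
    integral mu (fun x => integral nu (fun y => f (x + y)))).

Definition tilde_fun (f : G -> C) : G -> C := fun x => (f (- x))^*.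

Lemma supp_tilde_fun (f : G -> C) : supp (tilde_fun f) `<=` -%R @` supp f.
Proof.
move=> x sx; exists (- x); last exact: opprK.
move=> V nV; have [y [/= fy Vy]] := sx _ (@opp_continuous G x V nV).
by exists (- y); split => //=; move: fy; rewrite /tilde_fun conjC_eq0.
Qed.

Lemma tilde_fun_Cc (f : Cc) : tilde_fun f \in @Cc_pred R G.
Proof.
have /Cc_predP[cf kf] := valP f; apply/Cc_predP; split.
  have cJ : continuous ((fun z : C => z^*) : C -> C).
    move=> z V /nbhs_ballP[e e0 eV]; apply/nbhs_ballP; exists e => // w zw.
    apply: eV; move: zw; rewrite -!ball_normE /=.
    by rewrite -rmorphB norm_conjC.
  move=> x; apply: (@continuous_comp _ _ _ (f \o -%R) (fun z : C => z^*)).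
    by apply: continuous_comp; [exact: opp_continuous|exact: cf].
  exact: cJ.
have kN : compact (-%R @` supp f).
  apply: continuous_compact => //; apply: continuous_subspaceT.
  exact: opp_continuous.
apply: subclosed_compact kN _; first exact: closed_closure.
exact: supp_tilde_fun.
Qed.

Definition tilde_Cc (f : Cc) : Cc := MkCc (tilde_fun_Cc f).

Lemma tilde_cmeasure_pred (mu : cmeasure) :
  (fun f => (mu (tilde_Cc f))^*) \in cmeasure_pred.
Proof.
have /asboolP[lmu bmu] := valP mu; apply/asboolP; split.
  move=> k f g.
  have -> : tilde_Cc (k *: f + g) = k^* *: tilde_Cc f + tilde_Cc g.
    apply/val_inj/funext => x /=.
    by rewrite /tilde_fun /GRing.add/= /GRing.scale/= rmorphD rmorphM.
  by rewrite lmu rmorphD /GRing.scale/= rmorphM/= conjCK.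
move=> K kK.
have kNK : compact (-%R @` K).
  apply: continuous_compact => //; apply: continuous_subspaceT.
  exact: opp_continuous.
have [c c0 cP] := bmu _ kNK; exists c => // f fK.
have normcJ (z : C) : normc z^* = normc z by case: z => a b /=; rewrite sqrrN.
rewrite normcJ (le_trans (cP (tilde_Cc f) _))//.
  by apply: (subset_trans (@supp_tilde_fun f)); exact: image_subset.
rewrite le_eqVlt (_ : supnorm _ = supnorm f) ?eqxx//.
rewrite /supnorm; congr sup; apply/seteqP; split => _ [x _ <-]; exists (- x) => //.
  by rewrite /= /tilde_fun normcJ.
by rewrite /= /tilde_fun normcJ opprK.
Qed.

Definition tilde (mu : cmeasure) : cmeasure :=
  MkCmeasure (tilde_cmeasure_pred mu).

Definition vague_cvg (u : nat -> cmeasure) (theta : cmeasure) : Prop :=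
  forall f : Cc, u n f @[n --> \oo] --> theta f.

Section eberlein.
Context (m : {measure set (borel G) -> \bar R}).

Definition eberlein_seq (A : nat -> set G) (mu nu : cmeasure) (n : nat) :
    cmeasure :=
  ((fine (m (A n)))^-1)%:C%C *:
    convolution (restriction mu (A n)) (restriction nu (-%R @` A n)).

Definition eberlein_exists (A : nat -> set G) (mu nu : cmeasure) : Prop :=
  exists theta, vague_cvg (eberlein_seq A mu nu) theta.

(* The vague topology is Hausdorff, so [xget] selects the only limit. *)
Definition eberlein (A : nat -> set G) (mu nu : cmeasure) : cmeasure :=
  xget 0 [set theta | vague_cvg (eberlein_seq A mu nu) theta].

Definition twisted_exists (A : nat -> set G) (mu nu : cmeasure) : Prop :=
  eberlein_exists A mu (tilde nu).

Definition twisted (A : nat -> set G) (mu nu : cmeasure) : cmeasure :=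
  eberlein A mu (tilde nu).

End eberlein.
End complex_measures.

(* Main.v *)
(** The averages converge along a subsequence because they are uniformly bounded
    as functionals and [Cc] is separable.

    Restricting to an open set [A] amounts to a limit of [mu (w f)] along the
    directed set of continuous cutoffs [0 <= w <= 1_A]: the superadditivity of
    [var_sup] makes the residual [|mu|((1_A - w)|f|)] small, and the subadditivity
    of the upper integral identifies this limit with the integral of [1_A f].
    Directedness gives common cutoffs for several measures, hence linearity.
    The convolution of two restrictions at [f] is then [mu|_A] applied to the test
    function [x |-> nu|_B (f (x + .))], whose sup norm is at most
    [|f|_oo sup_t |nu|(t + supp f)].

    The remaining bound [|mu|(A_n) <= W |A_n|] is a packing argument: for a compact
    neighbourhood [K] of [0], a maximal family of [N] disjoint translates [t + K] with
    [t] in [A_n] satisfies [N |K| <= |A_n + K| <= |A_n| + |bd^K A_n|], while the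
    translates [t + K - K] cover [A_n]. *)

(* Several definitions carry default values: [restriction] and [convolution] are the zero measure
   when the given functional is not a measure, and [integral] picks a value of [has_integral]. Each
   formula for them therefore comes after a proof that the integral is unique and that the
   functional is linear and locally bounded.

   Linearity of the restriction in the measure is the delicate point: a sequence approximating 1_A f
   in L^1 of one variation need not do so for another. Hence the limits over a filter of cutoffs
   that depends on [A] alone.

   Limits are first found along ultrafilters, where bounded complex values converge; only afterwards
   does a countable dense family turn the ultrafilter into a subsequence.

   The linear identities hold at each index n, before any limit. In (c) to (f) it is thus enough to
   make two sequences converge; the combined one follows. *)
From HB Require Import structures.
Require Import Defs.
From mathcomp Require Import all_boot all_order all_algebra.
From mathcomp Require Import all_classical all_reals all_analysis.
From mathcomp Require Import complex.
From mathcomp Require Import ring lra.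
Import Defs.
Set Implicit Arguments.
Unset Strict Implicit.
Unset Printing Implicit Defensive.
Import Order.TTheory GRing.Theory Num.Theory numFieldNormedType.Exports.
Import Normc.
Local Open Scope classical_set_scope.
Local Open Scope ring_scope.

(** * Complex-valued limits *)

Section complex_topology.
Context {R : realType}.
Local Notation C := (R[i]^o).

Lemma normc_ge0 (z : C) : 0 <= normc z.
Proof. by case: z => a b; rewrite sqrtr_ge0. Qed.

Lemma normr_normc (z : C) : `|z| = (normc z)%:C%C.
Proof. by case: z => a b; rewrite normc_def. Qed.

Lemma normc_distC (z w : C) : normc (z - w) = normc (w - z).
Proof. by rewrite -normcN opprB. Qed.

Lemma normc_dist_triangle (w z t : C) :
  normc (z - t) <= normc (z - w) + normc (w - t).
Proof. by rewrite -(subrKA w z (- t)); exact: le_normcD. Qed.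

Lemma normc_conj (z : R[i]) : normc z^* = normc z.
Proof. by case: z => a b /=; rewrite sqrrN. Qed.

Lemma normc_real (x : R) : normc x%:C%C = `|x|.
Proof. by rewrite /= expr0n addr0 sqrtr_sqr. Qed.

Lemma ler_dist_normc (z w : C) : `|normc z - normc w| <= normc (z - w).
Proof.
rewrite ler_norml lerBlDr.
have := normc_dist_triangle w z 0; rewrite !subr0 => ->; rewrite andbT.
rewrite lerBrDl lerBlDr; have := normc_dist_triangle z w 0.
by rewrite !subr0 normc_distC addrC.
Qed.

(** The phase of [z]: it rotates values of a functional onto the positive axis, so that their moduli
    add. *)
Lemma normc_dual (z : C) : exists2 c : C, normc c = 1 & c * z = (normc z)%:C%C.
Proof.
have [->|z0] := eqVneq z 0.
  by exists 1; rewrite ?normc1// mulr0 normc0.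
have nz0 : normc z != 0 by apply: contra_neq z0; exact: eq0_normc.
exists ((normc z)%:C%C / z).
  by rewrite normcM normcV normc_real ger0_norm ?normc_ge0// divff.
by rewrite -mulrA mulVf// mulr1.
Qed.

(** Balls of [R[i]^o] have radii in [R[i]], whose positive elements are the positive reals; so the
    real modulus suffices. *)
Lemma nbhs_normcP (z : C) (V : set C) :
  nbhs z V <-> exists2 e : R, 0 < e & forall w, normc (z - w) < e -> V w.
Proof.
split.
  move=> /nbhs_ballP[/= e e0 eV].
  have eE : e = (complex.Re e)%:C%C by rewrite RRe_real// gtr0_real.
  exists (complex.Re e) => [|w zw]; first by rewrite eE ltcR in e0.
  by apply: eV; rewrite -ball_normE /= normr_normc eE ltcR.
move=> [e e0 eV]; apply/nbhs_ballP; exists e%:C%C; first by rewrite /= ltcR.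
by move=> w; rewrite -ball_normE /= normr_normc ltcR; exact: eV.
Qed.

Lemma cvg_normcP (T : Type) (F : set_system T) (f : T -> C) (z : C) :
  Filter F -> f @ F --> z <->
  forall e : R, 0 < e -> \forall x \near F, normc (f x - z) < e.
Proof.
move=> FF; split=> [fz e e0|fz V].
  have : nbhs z [set w | normc (w - z) < e].
    by apply/nbhs_normcP; exists e => // w; rewrite normc_distC.
  by move=> /fz.
move=> /nbhs_normcP[e e0 eV]; rewrite /fmap /=.
by apply: filterS (fz e e0) => x; rewrite normc_distC; exact: eV.
Qed.

Lemma normc_le_cvg (T : Type) (F : set_system T) (f : T -> C) (z w : C) (M : R) :
  ProperFilter F -> f @ F --> z -> (\forall x \near F, normc (f x - w) <= M) ->
  normc (z - w) <= M.
Proof.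
move=> PF /cvg_normcP fz fM; apply/ler_addgt0Pr => e e0.
have [x [fxz fxM]] := filter_ex (filterI (fz e e0) fM).
rewrite (le_trans (normc_dist_triangle (f x) z w))// addrC lerD//.
by rewrite normc_distC ltW.
Qed.

Lemma normc_cvg_unique (T : Type) (F : set_system T) (f : T -> C) (z w : C) :
  ProperFilter F -> f @ F --> z -> f @ F --> w -> z = w.
Proof.
move=> PF fz /cvg_normcP fw; apply/eqP; rewrite -subr_eq0; apply/eqP.
apply: eq0_normc; apply/eqP; rewrite eq_le normc_ge0 andbT.
apply/ler_addgt0Pr => e e0; rewrite add0r; apply: (normc_le_cvg PF fz).
by apply: filterS (fw e e0) => x /ltW.
Qed.

Lemma normc_le_absD (z : C) : normc z <= `|complex.Re z| + `|complex.Im z|.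
Proof.
case: z => a b /=; rewrite -[leRHS]ger0_norm ?addr_ge0// -sqrtr_sqr ler_sqrt.
  rewrite sqrrD !real_normK ?num_real// -addrA lerD2l lerDr mulrn_wge0//.
  by rewrite mulr_ge0.
Qed.

Lemma normc_ge_absRe (z : C) : `|complex.Re z| <= normc z.
Proof. by have := normc_ge_Re z; rewrite normr_normc lecR. Qed.

Lemma normc_ge_absIm (z : C) : `|complex.Im z| <= normc z.
Proof.
case: z => a b /=; rewrite -sqrtr_sqr ler_wsqrtr// lerDr.
exact: sqr_ge0.
Qed.

(** The segment is compact, so the image filter has a cluster point, and a cluster point of an
    ultrafilter is a limit. *)
Lemma ultra_cvg_bounded (T : Type) (F : set_system T) (f : T -> R) (M : R) :
  UltraFilter F -> (\forall x \near F, `|f x| <= M) -> exists l : R, f @ F --> l.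
Proof.
move=> UF fM.
have fI : (f @ F) [set` `[- M, M]].
  by apply: filterS fM => x /=; rewrite in_itv/= ler_norml.
have PF : ProperFilter (f @ F) by exact: fmap_proper_filter.
have [l [_ fl]] := @segment_compact R (- M) M (f @ F) PF fI.
exists l => V lV; have [//|FnV] := in_ultra_setVsetC (f @^-1` V) UF.
by have [y []] := fl (~` V) V FnV lV.
Qed.

Lemma ultra_cvg_normc_bounded (T : Type) (F : set_system T) (f : T -> C) (M : R) :
  UltraFilter F -> (\forall x \near F, normc (f x) <= M) -> exists l : C, f @ F --> l.
Proof.
move=> UF fM.
have [p /cvgrPdist_lt fp] := @ultra_cvg_bounded _ F (fun x => complex.Re (f x)) M UF
  (filterS (fun x => le_trans (normc_ge_absRe (f x))) fM).
have [q /cvgrPdist_lt fq] := @ultra_cvg_bounded _ F (fun x => complex.Im (f x)) M UF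
  (filterS (fun x => le_trans (normc_ge_absIm (f x))) fM).
exists (p +i* q)%C; apply/cvg_normcP => e e0.
have e20 : 0 < e / 2 by rewrite divr_gt0.
apply: filterS2 (fp _ e20) (fq _ e20) => x xp xq.
rewrite (le_lt_trans (normc_le_absD _))// [ltRHS]splitr.
move: xp xq; case: (f x) => u v /=.
by rewrite distrC => xp; rewrite distrC => xq; exact: ltrD.
Qed.

End complex_topology.

(** * Topological groups and test functions *)

Section topological_group.
Context {G : topologicalZmodType}.
Implicit Types (A K L V : set G) (x t : G).

Lemma addl_continuous t : continuous (fun x : G => t + x).
Proof.
move=> x; apply: (@continuous_comp _ _ _ (fun x => (t, x)) (fun x : G * G => x.1 + x.2)).
  by apply: cvg_pair => /=; [exact: cvg_cst|exact: cvg_id].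
exact: add_continuous.
Qed.

Lemma nbhs_addl t x V : nbhs (t + x) V -> nbhs x [set y | V (t + y)].
Proof. exact: addl_continuous. Qed.

Lemma nbhs0_symmetric V : nbhs (0 : G) V ->
  nbhs (0 : G) (V `&` [set v | V (- v)]).
Proof.
move=> V0; apply: filterI => //.
by apply: (@opp_continuous G 0); rewrite oppr0.
Qed.

Lemma compactD K L : compact K -> compact L ->
  compact [set x + y | x in K & y in L].
Proof.
move=> cK cL.
rewrite (_ : [set _ | _ in _ & _ in _] = (fun z : G * G => z.1 + z.2) @` (K `*` L)).
  apply: continuous_compact; last exact: compact_setX.
  by apply: continuous_subspaceT; exact: add_continuous.
apply/seteqP; split=> [_ [x Kx [y Ly <-]]|_ [[x y] [/= Kx Ly] <-]].
  by exists (x, y).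
by exists x => //; exists y.
Qed.

Lemma compactN K : compact K -> compact (-%R @` K).
Proof.
move=> cK; apply: continuous_compact => //; apply: continuous_subspaceT.
exact: opp_continuous.
Qed.

Lemma compact_addl t K : compact K -> compact [set t + x | x in K].
Proof.
move=> cK; apply: continuous_compact => //; apply: continuous_subspaceT.
exact: addl_continuous.
Qed.

Lemma openN A : open A -> open (-%R @` A).
Proof.
rewrite (_ : -%R @` A = -%R @^-1` A).
  move=> oA; apply: open_comp => // x _; exact: opp_continuous.
apply/seteqP; split=> [_ [x Ax <-] /=|x /= Ax]; first by rewrite opprK.
by exists (- x) => //; rewrite opprK.
Qed.

Lemma locally_compact_nbhs (lcG : locally_compact [set: G]) x :
  exists2 K, nbhs x K & compact K.
Proof.
have [K wK [cK _]] := lcG x I; exists K => //.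
have : nbhs x (fun y => [set: G] y -> K y) := wK.
by apply: filterS => y; exact.
Qed.

(** A tube argument: if x + y avoids [A] for every y in the compact [K], so does x' + y for all x'
    near x. It serves the measurability of the van Hove boundary. *)
Lemma closedB A K : closed A -> compact K ->
  closed [set x - y | x in A & y in K].
Proof.
move=> cA /compact_near_coveringP cK; rewrite -openC openE => x /= xAK.
have : \forall x' \near x, K `<=` [set y | ~ A (x' + y)].
  apply: cK => y Ky.
  have nA : nbhs (x + y) (~` A).
    apply: open_nbhs_nbhs; split; first exact: closed_openC.
    by move=> Axy; apply: xAK; exists (x + y) => //; exists y => //; rewrite addrK.
  have [[U V] /= [Ux Vy] UV] := @add_continuous G (x, y) _ nA.
  by exists (V, U) => // -[y' x'] [/= Vy' Ux']; exact: (UV (x', y')).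
apply: filterS => x' KA [z Az [y Ky zyx]]; apply: (KA _ Ky).
by rewrite -zyx subrK.
Qed.

End topological_group.

Section test_functions.
Context {R : realType} {G : topologicalZmodType}.
Hypothesis hausG : hausdorff_space G.
Local Notation C := (R[i]^o).
Local Notation Cc := (Cc R G).
Implicit Types (f g : Cc) (K : set G) (phi : G -> R).

Lemma Cc_intro (F : G -> C) K : continuous F -> compact K ->
  (forall x, F x != 0 -> K x) -> F \in @Cc_pred R G.
Proof.
move=> cF cK FK; apply/Cc_predP; split=> //.
apply: subclosed_compact (cK) _; first exact: closed_closure.
have /closure_id -> := compact_closed hausG cK.
exact: closureS.
Qed.

Lemma Cc_continuous f : continuous f.
Proof. by case/Cc_predP: (valP f). Qed.

Lemma compact_supp f : compact (supp f).
Proof. by case/Cc_predP: (valP f). Qed.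

Lemma supp_neq0 f x : f x != 0 -> supp f x.
Proof. by move=> fx; apply: (@subset_closure _ [set y | f y != 0]). Qed.

Lemma supp_eq0 f x : ~ supp f x -> f x = 0.
Proof. by apply: contra_notP => /eqP; exact: supp_neq0. Qed.

Lemma supp_sub f K : compact K -> (forall x, f x != 0 -> K x) -> supp f `<=` K.
Proof.
move=> cK fK; have /closure_id -> := compact_closed hausG cK.
exact: closureS.
Qed.

Lemma normc_Cc_lt f x (e : R) : 0 < e ->
  \forall y \near x, normc (f y - f x) < e.
Proof. by move: e; apply/cvg_normcP; exact: Cc_continuous. Qed.

Lemma continuous_normcP (F : G -> C) : continuous F <->
  forall x (e : R), 0 < e -> \forall y \near x, normc (F y - F x) < e.
Proof.
by split=> [cF x|cF x]; [apply/cvg_normcP; exact: cF|apply/cvg_normcP; exact: cF].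
Qed.

Lemma continuous_real_complex phi : continuous phi ->
  continuous ((fun x => (phi x)%:C%C) : G -> C).
Proof.
move=> cphi; apply/continuous_normcP => x e e0.
have /cvgrPdist_lt/(_ e e0) := cphi x.
apply: filterS => y; rewrite -raddfB normc_real distrC; exact.
Qed.

Lemma continuous_normc (F : G -> C) : continuous F ->
  continuous (fun x => normc (F x)).
Proof.
move=> cF x; apply/cvgrPdist_lt => e e0.
have /continuous_normcP/(_ x e e0) := cF.
apply: filterS => y /(le_lt_trans (ler_dist_normc _ _)).
by rewrite distrC.
Qed.

Lemma supnorm_has_ubound f : has_ubound (range (fun x => normc (f x))).
Proof.
have cn : compact ((fun x => normc (f x)) @` supp f).
  apply: continuous_compact; last exact: compact_supp.
  apply: continuous_subspaceT; exact/continuous_normc/Cc_continuous.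
have [M [_ fM]] := compact_bounded cn.
exists (Num.max 0 (M + 1)) => _ [x _ <-].
have [sx|/supp_eq0 ->] := pselect (supp f x); last by rewrite normc0 le_max lexx.
have M1 : M < M + 1 by rewrite ltrDl.
have := fM _ M1 (normc (f x)) (ex_intro2 _ _ x sx erefl).
by rewrite /= ger0_norm ?normc_ge0// le_max => ->; rewrite orbT.
Qed.

Lemma normc_le_supnorm f x : normc (f x) <= supnorm f.
Proof. by apply: ub_le_sup; [exact: supnorm_has_ubound|exists x]. Qed.

Lemma supnorm_le (F : G -> C) (M : R) :
  (forall x, normc (F x) <= M) -> supnorm F <= M.
Proof.
move=> FM; apply: ge_sup; first by exists (normc (F 0)), 0.
by move=> _ [x _ <-].
Qed.

Lemma scale_real_Cc phi f : continuous phi ->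
  (fun x => (phi x)%:C%C * f x) \in @Cc_pred R G.
Proof.
move=> cphi; apply: (@Cc_intro _ (supp f)).
- move=> x; apply: (@cvgM _ _ _ _ _ _ (phi x)%:C%C (f x)).
    exact: continuous_real_complex.
  exact: Cc_continuous.
- exact: compact_supp.
- by move=> x; rewrite mulf_eq0 negb_or => /andP[_]; exact: supp_neq0.
Qed.

Definition scale_real phi (cphi : continuous phi) f : Cc :=
  MkCc (scale_real_Cc f cphi).

Lemma translate_Cc (t : G) f : (fun x => f (t + x)) \in @Cc_pred R G.
Proof.
apply: (@Cc_intro _ [set - t + x | x in supp f]).
- by move=> x; apply: continuous_comp; [exact: addl_continuous|exact: Cc_continuous].
- exact/compact_addl/compact_supp.
- by move=> x fx; exists (t + x); [exact: supp_neq0|rewrite addKr].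
Qed.

Definition translate (t : G) f : Cc := MkCc (translate_Cc t f).

(** Near-covering over the support makes the local estimates uniform in [y]; the other points are
    reached through a symmetric neighbourhood. *)
Lemma Cc_uniform_continuous f (e : R) : 0 < e ->
  \forall v \near (0 : G), forall y, normc (f (v + y) - f y) < e.
Proof.
move=> e0.
have /compact_near_coveringP cf := @compact_supp f.
have : \forall v \near (0 : G), supp f `<=` [set y | normc (f (v + y) - f y) < e].
  apply: cf => y _.
  have e20 : 0 < e / 2 by rewrite divr_gt0.
  have nV := normc_Cc_lt f y e20.
  have nV' : nbhs (0 + y) [set z | normc (f z - f y) < e / 2] by rewrite add0r.
  have [[U V] /= [U0 Vy] UV] := @add_continuous G (0, y) _ nV'.
  exists (V `&` [set z | normc (f z - f y) < e / 2], U).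
    by split=> //=; exact: filterI.
  move=> [z v] [/= [Vz fz] Uv].
  rewrite (le_lt_trans (normc_dist_triangle (f y) _ _))// [ltRHS]splitr.
  by rewrite ltrD// ?(UV (v, z))// normc_distC.
move=> /nbhs0_symmetric; apply: filterS => v [/= sv sNv] y.
have [sy|/[dup] nsy /supp_eq0 fy] := pselect (supp f y); first exact: sv.
(* With [y] off the support and [v + y] in it, the estimate at [v + y] for the translation [- v] is
   the one wanted. *)
have [svy|/supp_eq0 fvy] := pselect (supp f (v + y)).
  by have := sNv _ svy; rewrite /= addKr normc_distC.
by rewrite fy fvy subr0 normc0.
Qed.

(** Complete regularity separates [x] from the complement of the interior of [U] intersected with a
    compact neighbourhood [B]. The separator is 0 at [x] and 1 off that interior, so 1 minus it is
    the bump, and [B] makes its support compact. *)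
Lemma Cc_bump (lcG : locally_compact [set: G]) (x : G) (U : set G) :
  nbhs x U -> exists2 phi : G -> R, continuous phi &
    [/\ forall y, 0 <= phi y <= 1, phi x = 1,
        (forall y, phi y != 0 -> U y) &
        (fun y => (phi y)%:C%C) \in @Cc_pred R G].
Proof.
move=> xU.
have [B xB cB] := locally_compact_nbhs lcG x.
have sep : uniform_separator [set x] (~` (U `&` B)^°).
  apply: (@locally_compact_completely_regular G R lcG hausG).
    exact/open_closedC/open_interior.
  by move=> nUB; apply: nUB; exact: filterI.
have [phi [cphi phi01 phix phiU]] := (@uniform_separatorP G R _ _).1 sep.
have phi_itv y : 0 <= phi y <= 1.
  by have := phi01 _ (ex_intro2 _ _ y I erefl); rewrite /= in_itv.
have phi0 y : 1 - phi y != 0 -> (U `&` B) y.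
  move=> phiy; apply: interior_subset; apply: contrapT => nUy.
  have := phiU (phi y) (ex_intro2 _ _ y nUy erefl) => /= phiy1.
  by rewrite phiy1 subrr eqxx in phiy.
exists (fun y => 1 - phi y).
  by move=> y; apply: cvgB; [exact: cvg_cst|exact: cphi].
split.
- by move=> y; have := phi_itv y; rewrite subr_ge0 lerBlDr lerDl andbC.
- by have := phix (phi x) (ex_intro2 _ _ x erefl erefl) => /= ->; rewrite subr0.
- by move=> y /phi0[].
- apply: (@Cc_intro _ B) => //.
    apply: continuous_real_complex => y.
    by apply: cvgB; [exact: cvg_cst|exact: cphi].
  by move=> y; rewrite -[0]/(0%:C%C) (inj_eq (@complexI _)) => /phi0[].
Qed.
End test_functions.

(** * The variation on lower semicontinuous functions *)

Section lower_semicontinuity.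
Context {R : realType} {X : topologicalType}.
Implicit Types (h k : X -> \bar R) (psi : X -> R).

Lemma lower_semicontinuous_EFin psi : continuous psi ->
  lower_semicontinuous (fun x => (psi x)%:E).
Proof.
move=> cpsi x a; rewrite lte_fin => apsi; exists [set y | a < psi y].
  exact: (cvgr_gt (psi x) (cpsi x)).
by move=> y /=; rewrite lte_fin.
Qed.

Lemma lower_semicontinuous_indic (A : set X) psi : open A -> continuous psi ->
  (forall x, 0 <= psi x) -> lower_semicontinuous (fun x => (\1_A x * psi x)%:E).
Proof.
move=> oA cpsi psi0 x a; rewrite lte_fin !indicE.
have [/[!inE] Ax|_] := boolP (x \in A).
  rewrite mul1r => apsi; exists (A `&` [set y | a < psi y]).
    by apply: filterI; [exact: open_nbhs_nbhs|exact: (cvgr_gt (psi x) (cpsi x))].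
  by move=> y [Ay /= apsiy]; rewrite lte_fin indicE mem_set// mul1r.
rewrite mul0r => a0; exists setT; first exact: filterT.
by move=> y _; rewrite lte_fin indicE (lt_le_trans a0)// mulr_ge0.
Qed.

Lemma lte_split_add (a : R) (u v : \bar R) : (0 <= u)%E -> (0 <= v)%E ->
  (a%:E < u + v)%E -> exists b c, [/\ (b%:E < u)%E, (c%:E < v)%E & a = b + c].
Proof.
case: u v => [u| |] [v| |] //=; rewrite ?lee_fin.
- move=> _ _; rewrite -EFinD lte_fin => auv.
  exists (u - (u + v - a) / 2), (v - (u + v - a) / 2); rewrite !lte_fin.
  have d0 : 0 < (u + v - a) / 2 by rewrite divr_gt0// subr_gt0.
  split; rewrite ?gtrBl//.
  by rewrite addrACA -opprD -splitr opprB addrC subrK.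
- move=> _ _ _; exists (u - 1), (a - (u - 1)); split; rewrite ?ltry//.
    by rewrite lte_fin gtrBl.
  by rewrite addrC subrK.
- move=> _ v0 _; exists (a - (v - 1)), (v - 1); split; rewrite ?ltry//.
    by rewrite lte_fin gtrBl.
  by rewrite subrK.
- move=> _ _ _; exists a, 0; split; rewrite ?ltry//.
  by rewrite addr0.
Qed.

Lemma lower_semicontinuousD h k : (forall x, (0 <= h x)%E) ->
  (forall x, (0 <= k x)%E) -> lower_semicontinuous h -> lower_semicontinuous k ->
  lower_semicontinuous (fun x => h x + k x)%E.
Proof.
move=> h0 k0 lh lk x a /(lte_split_add (h0 x) (k0 x))[b [c [bh ck ->]]].
have [U xU Uh] := lh x b bh; have [V xV Vk] := lk x c ck.
exists (U `&` V); first exact: filterI.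
by move=> y [/Uh by_ /Vk cy]; rewrite EFinD lteD.
Qed.

End lower_semicontinuity.

Lemma cvge0_lt (R : realType) (T : Type) (F : set_system T) (u : T -> \bar R) :
  Filter F -> u @ F --> 0%E -> forall e : R, 0 < e ->
  \forall x \near F, (u x < e%:E)%E.
Proof.
move=> FF u0 e e0.
have : nbhs (0%E : \bar R) [set y | (y < e%:E)%E].
  apply: open_nbhs_nbhs; split; first exact: open_ereal_lt_ereal.
  by rewrite /= lte_fin.
by move=> /u0.
Qed.

Section variation.
Context {R : realType} {G : topologicalZmodType}.
Hypotheses (hausG : hausdorff_space G) (lcG : locally_compact [set: G]).
Local Notation C := (R[i]^o).
Local Notation Cc := (Cc R G).
Local Notation cmeasure := (cmeasure R G).
Implicit Types (mu nu : cmeasure) (f g u v : Cc) (h k : G -> \bar R).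

Lemma cmeasure_linear mu : linear mu.
Proof. by case/asboolP: (valP mu). Qed.

Lemma cmeasure_bounded mu (K : set G) : compact K -> exists2 c : R, 0 < c &
  forall f, supp f `<=` K -> normc (mu f) <= c * supnorm f.
Proof. by case/asboolP: (valP mu) => _; exact. Qed.

HB.instance Definition _ mu :=
  GRing.isLinear.Build R[i] Cc C _ (cmeasure_fun mu) (cmeasure_linear mu).

Lemma cmeasureD mu f g : mu (f + g) = mu f + mu g.
Proof. exact: raddfD. Qed.

Lemma cmeasureB mu f g : mu (f - g) = mu f - mu g.
Proof. exact: raddfB. Qed.

Lemma cmeasureZ mu (a : R[i]) f : mu (a *: f) = a * mu f.
Proof. exact: linearZ. Qed.

Lemma Cc_addE f g x : (f + g) x = f x + g x. Proof. by []. Qed.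
Lemma Cc_oppE f x : (- f) x = - f x. Proof. by []. Qed.
Lemma Cc_scaleE (a : R[i]) f x : (a *: f) x = a * f x. Proof. by []. Qed.

Lemma normc_le_var_sup mu g h : (forall x, ((normc (g x))%:E <= h x)%E) ->
  ((normc (mu g))%:E <= var_sup mu h)%E.
Proof. by move=> gh; apply: ereal_sup_ubound; exists g. Qed.

Lemma var_sup_le mu h (M : \bar R) :
  (forall g, (forall x, ((normc (g x))%:E <= h x)%E) -> ((normc (mu g))%:E <= M)%E) ->
  (var_sup mu h <= M)%E.
Proof. by move=> hM; apply: ge_ereal_sup => _ [g gh <-]; exact: hM. Qed.

Lemma le_var_sup mu h k : (forall x, (h x <= k x)%E) ->
  (var_sup mu h <= var_sup mu k)%E.
Proof.
move=> hk; apply: var_sup_le => g gh; apply: normc_le_var_sup => x.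
exact: le_trans (gh x) (hk x).
Qed.

Lemma var_sup_ge0 mu h : (forall x, (0 <= h x)%E) -> (0 <= var_sup mu h)%E.
Proof.
move=> h0; rewrite -[0%E]/((0%R : R)%:E) -(@normc0 R) -(raddf0 mu).
by apply: normc_le_var_sup => x; rewrite [_ x]/(0%R) normc0.
Qed.

(* Unimodular multiples of [u] and [v] align the phases of [mu u] and [mu v]. *)
Lemma var_sup_superadd mu u h k : (forall x, ((normc (u x))%:E <= h x)%E) ->
  ((normc (mu u))%:E + var_sup mu k <= var_sup mu (fun x => h x + k x))%E.
Proof.
move=> uh; rewrite addeC -leeBrDr//; apply: var_sup_le => v vk.
rewrite leeBrDr// -EFinD.
have [c c1 cu] := normc_dual (mu u); have [d d1 dv] := normc_dual (mu v).
have -> : normc (mu v) + normc (mu u) = normc (mu (c *: u + d *: v)).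
  by rewrite cmeasureD !cmeasureZ cu dv -raddfD normc_real ger0_norm 1?addrC// addr_ge0// normc_ge0.
apply: normc_le_var_sup => x; rewrite Cc_addE !Cc_scaleE.
apply: (@le_trans _ _ (normc (u x) + normc (v x))%:E); last by rewrite EFinD leeD.
by rewrite lee_fin (le_trans (le_normcD _ _))// !normcM c1 d1 !mul1r.
Qed.

(** These stay real-valued where [h] is infinite, and they are directed by [minorant_max]. For lower
    semicontinuous [h >= 0] their pointwise supremum is [h]. *)
Definition minorant h (phi : G -> R) :=
  continuous phi /\ forall x, 0 <= phi x /\ ((phi x)%:E <= h x)%E.

Lemma minorant_max h (phi psi : G -> R) : minorant h phi -> minorant h psi ->
  minorant h (fun x => Num.max (phi x) (psi x)).
Proof.
move=> [cphi hphi] [cpsi hpsi]; split=> [x|x].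
  exact: (@continuous_max R G phi psi x (cphi x) (cpsi x)).
have [phi0 phih] := hphi x; have [psi0 psih] := hpsi x.
by split; [rewrite le_max phi0|rewrite maxEle; case: ifP].
Qed.

Lemma minorant0 h : (forall x, (0 <= h x)%E) -> minorant h (fun=> 0).
Proof. by move=> h0; split=> // x; exact: cvg_cst. Qed.

(** A bump at [x], scaled by [t] and vanishing off a set where h > t, stays below [h]. *)
Lemma lower_semicontinuous_minorant h x (t : R) : (forall y, (0 <= h y)%E) ->
  lower_semicontinuous h -> (t%:E < h x)%E -> exists2 phi, minorant h phi & t <= phi x.
Proof.
move=> h0 lh th; have [t0|t0] := leP t 0; first by exists (fun=> 0) => //; exact: minorant0.
have [V xV Vh] := lh x t th.
have [phi cphi [phi01 phix phiV _]] := @Cc_bump R G hausG lcG x V xV.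
exists (fun y => t * phi y); last by rewrite phix mulr1.
split=> y; first by apply: cvgMr; exact: cphi.
have /andP[phi0 phi1] := phi01 y.
split; first by rewrite mulr_ge0// ltW.
have [->|/phiV /Vh/ltW] := eqVneq (phi y) 0; first by rewrite mulr0.
by apply: le_trans; rewrite lee_fin ler_piMr// ltW.
Qed.

(* Pairs of minorants form a directed set, so compactness of the support is used
   as near-covering with respect to that direction. *)
Lemma sum_minorants h k g (e : R) : 0 < e ->
  (forall x, (0 <= h x)%E) -> (forall x, (0 <= k x)%E) ->
  lower_semicontinuous h -> lower_semicontinuous k ->
  (forall x, ((normc (g x))%:E <= h x + k x)%E) ->
  exists phi psi, [/\ minorant h phi, minorant k psi &
    forall x, supp g x -> normc (g x) < phi x + psi x + e].
Proof.
move=> e0 h0 k0 lh lk ghk.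
pose D := [set p : (G -> R) * (G -> R) | minorant h p.1 /\ minorant k p.2].
pose B (p : (G -> R) * (G -> R)) :=
  [set q | D q /\ forall x, p.1 x <= q.1 x /\ p.2 x <= q.2 x].
have FF : Filter (filter_from D B).
  apply: filter_from_filter; first by exists (fun=> 0, fun=> 0); split; exact: minorant0.
  move=> [p1 p2] [q1 q2] [/= hp1 kp2] [/= hq1 kq2].
  exists (fun x => Num.max (p1 x) (q1 x), fun x => Num.max (p2 x) (q2 x)).
    by split; exact: minorant_max.
  move=> r [Dr rpq]; split; split=> // x; have [] := rpq x => /=;
    by rewrite !ge_max => /andP[? ?] /andP[].
have /compact_near_coveringP/(_ _ (filter_from D B)
  (fun p x => normc (g x) < p.1 x + p.2 x + e) FF) := @compact_supp R G g.
case=> [x _|p Dp pB].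
  have [b [c [bh ck gbc]]] : exists b c,
      [/\ (b%:E < h x)%E, (c%:E < k x)%E & normc (g x) - e / 2 = b + c].
    apply: lte_split_add => //; apply: lt_le_trans (ghk x).
    by rewrite lte_fin gtrBl divr_gt0.
  have [phi hphi bphi] := lower_semicontinuous_minorant h0 lh bh.
  have [psi kpsi cpsi] := lower_semicontinuous_minorant k0 lk ck.
  exists ([set y | normc (g y) < phi y + psi y + e], B (phi, psi)).
    split; last by exists (phi, psi).
    have cphi := hphi.1; have cps := kpsi.1.
    have cd : continuous (fun y => phi y + psi y + e - normc (g y)).
      move=> y; apply: cvgB; last exact: (continuous_normc (@Cc_continuous _ _ g)).
      by apply: cvgD; [apply: cvgD; [exact: cphi|exact: cps]|exact: cvg_cst].
    have dx : 0 < phi x + psi x + e - normc (g x).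
      rewrite subr_gt0 -ltrBlDr (lt_le_trans _ (lerD bphi cpsi))// -gbc.
      by rewrite ltrD2l ltrN2 ltr_pdivrMr// ltr_pMr// ltr1n.
    have : \forall y \near x, 0 < phi y + psi y + e - normc (g y).
      exact: (cvgr_gt _ (cd x)).
    by rewrite /=; apply: filterS => y; rewrite subr_gt0.
  move=> [y q] [/= gy [_ pq]]; apply: (lt_le_trans gy); rewrite lerD2r.
  by have [] := pq y; exact: lerD.
exists p.1, p.2; case: (Dp) => hp kp; split=> // x sx.
by apply: pB => //; split=> // y.
Qed.

(** A test function [g] dominated by h + k is split in the proportion phi : psi : e / c, where the
    minorants [phi] and [psi] satisfy |g| < phi + psi + e / c on the support. The three pieces are
    dominated by [phi], [psi] and e / c. *)
Lemma var_sup_subadd mu h k : (forall x, (0 <= h x)%E) -> (forall x, (0 <= k x)%E) ->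
  lower_semicontinuous h -> lower_semicontinuous k ->
  (var_sup mu (fun x => h x + k x) <= var_sup mu h + var_sup mu k)%E.
Proof.
move=> h0 k0 lh lk; apply: var_sup_le => g ghk.
have [c c0 cP] := cmeasure_bounded mu (@compact_supp _ _ g).
apply/lee_addgt0Pr => e e0.
(* [c] bounds [mu] on the support of [g], so the third piece, of sup norm at most e / c, costs at
   most [e]. *)
have d0 : 0 < e / c by rewrite divr_gt0.
have [phi [psi [[cphi hphi] [cpsi kpsi] gsum]]] := sum_minorants d0 h0 k0 lh lk ghk.
(* The constant keeps the denominator positive everywhere, hence the quotients continuous. *)
pose D x := phi x + psi x + e / c.
have D0 x : 0 < D x.
  by have [? _] := hphi x; have [? _] := kpsi x; rewrite /D ltr_wpDl// addr_ge0.
have cD : continuous D.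
  by move=> x; apply: cvgD; [apply: cvgD; [exact: cphi|exact: cpsi]|exact: cvg_cst].
have cV : continuous (fun x => (D x)^-1).
  by move=> x; apply: cvgV; [rewrite gt_eqF|exact: cD].
have cdiv (a : G -> R) : continuous a -> continuous (fun x => a x / D x).
  by move=> ca x; apply: cvgM; [exact: ca|exact: cV].
have ce : continuous (fun _ : G => e / c) by move=> x; exact: cvg_cst.
have bound (a : G -> R) (ca : continuous (fun x => a x / D x)) : (forall x, 0 <= a x) ->
    forall x, normc (scale_real hausG ca g x) <= a x.
  move=> a0 x; rewrite /= normcM normc_real ger0_norm ?(divr_ge0 (a0 x) (ltW (D0 x)))//.
  have [sx|/supp_eq0 ->] := pselect (supp g x); last by rewrite normc0 mulr0.
  by rewrite mulrAC ler_pdivrMr// ler_wpM2l// ltW// gsum.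
pose g1 := scale_real hausG (cdiv _ cphi) g; pose g2 := scale_real hausG (cdiv _ cpsi) g.
pose g3 := scale_real hausG (cdiv _ ce) g.
have -> : g = g1 + g2 + g3.
  apply/val_inj/funext => x; rewrite /= [in RHS]/GRing.add/= -!mulrDl -!raddfD/=.
  have -> : phi x / D x + psi x / D x + e / c / D x = 1.
    by rewrite -!mulrDl -/(D x) divff// gt_eqF// D0.
  by rewrite mul1r.
rewrite !raddfD.
apply: (@le_trans _ _ ((normc (mu g1))%:E + (normc (mu g2))%:E + (normc (mu g3))%:E)%E).
  by rewrite -!EFinD lee_fin (le_trans (le_normcD _ _))// lerD2r le_normcD.
apply: leeD; last first.
  rewrite lee_fin (le_trans (cP _ _))//.
    apply: supp_sub => //; first exact: compact_supp.
    by move=> x; rewrite mulf_eq0 negb_or => /andP[_]; exact: supp_neq0.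
  by rewrite mulrC -ler_pdivlMr//; apply: supnorm_le; apply: bound => ?; rewrite ltW.
apply: leeD; apply: normc_le_var_sup => x.
  have [_ ub] := hphi x; apply: le_trans ub; rewrite lee_fin.
  by apply: bound => y; have [] := hphi y.
have [_ ub] := kpsi x; apply: le_trans ub; rewrite lee_fin.
by apply: bound => y; have [] := kpsi y.
Qed.

End variation.

(** * The upper integral *)

Section upper_integral.
Context {R : realType} {G : topologicalZmodType}.
Hypotheses (hausG : hausdorff_space G) (lcG : locally_compact [set: G]).
Local Notation C := (R[i]^o).
Local Notation Cc := (Cc R G).
Local Notation cmeasure := (cmeasure R G).
Implicit Types (mu nu : cmeasure) (f g : Cc) (h k : G -> \bar R).

Lemma upper_integral_le mu h k : lower_semicontinuous h ->
  (forall x, (k x <= h x)%E) -> (upper_integral mu k <= var_sup mu h)%E.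
Proof. by move=> lh kh; apply: ereal_inf_lbound; exists h. Qed.

Lemma upper_integral_ge mu k (M : \bar R) :
  (forall h, lower_semicontinuous h -> (forall x, (k x <= h x)%E) ->
     (M <= var_sup mu h)%E) -> (M <= upper_integral mu k)%E.
Proof. by move=> kM; apply: le_ereal_inf_tmp => _ [h [lh kh] <-]; exact: kM. Qed.

Lemma upper_integral_ge0 mu k : (forall x, (0 <= k x)%E) ->
  (0 <= upper_integral mu k)%E.
Proof.
move=> k0; apply: upper_integral_ge => h lh kh; apply: var_sup_ge0 => x.
exact: le_trans (k0 x) (kh x).
Qed.

Lemma le_upper_integral mu h k : (forall x, (h x <= k x)%E) ->
  (upper_integral mu h <= upper_integral mu k)%E.
Proof.
move=> hk; apply: upper_integral_ge => l ll kl; apply: upper_integral_le => // x.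
exact: le_trans (hk x) (kl x).
Qed.

(** Sums of lower semicontinuous majorants are again such majorants, so [var_sup_subadd] carries
    over to the infima. *)
Lemma upper_integralD mu h k : (forall x, (0 <= h x)%E) -> (forall x, (0 <= k x)%E) ->
  (upper_integral mu (fun x => h x + k x) <=
   upper_integral mu h + upper_integral mu k)%E.
Proof.
move=> h0 k0.
have key h' k' : lower_semicontinuous h' -> (forall x, (h x <= h' x)%E) ->
    lower_semicontinuous k' -> (forall x, (k x <= k' x)%E) ->
    (upper_integral mu (fun x => h x + k x) <= var_sup mu h' + var_sup mu k')%E.
  move=> lh' hh' lk' kk'.
  have h'0 x : (0 <= h' x)%E by exact: le_trans (h0 x) (hh' x).
  have k'0 x : (0 <= k' x)%E by exact: le_trans (k0 x) (kk' x).
  apply: le_trans (var_sup_subadd hausG lcG mu h'0 k'0 lh' lk').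
  apply: upper_integral_le; first exact: lower_semicontinuousD.
  by move=> x; apply: leeD.
apply/lee_addgt0Pr => e e0.
have [hoo|hfin] := eqVneq (upper_integral mu h) +oo%E.
  by rewrite hoo addye ?leey// gt_eqF// (lt_le_trans _ (upper_integral_ge0 mu k0))// ltNyr.
have [koo|kfin] := eqVneq (upper_integral mu k) +oo%E.
  by rewrite koo addey ?leey// gt_eqF// (lt_le_trans _ (upper_integral_ge0 mu h0))// ltNyr.
have hf : upper_integral mu h \is a fin_num.
  by rewrite ge0_fin_numE ?upper_integral_ge0// lt_neqAle hfin leey.
have kf : upper_integral mu k \is a fin_num.
  by rewrite ge0_fin_numE ?upper_integral_ge0// lt_neqAle kfin leey.
have e20 : 0 < e / 2 by rewrite divr_gt0.
have [_ [h' [lh' hh'] <-] h'e] := lb_ereal_inf_adherent e20 hf.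
have [_ [k' [lk' kk'] <-] k'e] := lb_ereal_inf_adherent e20 kf.
apply: le_trans (key h' k' lh' hh' lk' kk') _.
by rewrite (splitr e) EFinD addeACA leeD// ltW.
Qed.

Lemma normc_le_upper_integral mu f :
  ((normc (mu f))%:E <= upper_integral mu (fun x => (normc (f x))%:E))%E.
Proof.
by apply: upper_integral_ge => h lh fh; apply: normc_le_var_sup.
Qed.

(** The modulus of f / M lies below every lower semicontinuous majorant of the indicator. The case M
    = 0, where one cannot divide, forces f = 0. *)
Lemma normc_le_variation mu f (B : set G) (M : R) : 0 <= M ->
  (forall x, normc (f x) <= M * \1_B x) ->
  ((normc (mu f))%:E <= M%:E * variation mu B)%E.
Proof.
rewrite le_eqVlt => /predU1P[<- f0|M0 fM].
  rewrite (_ : f = 0) ?raddf0 ?normc0 ?mul0e//; apply/val_inj/funext => x.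
  by apply: eq0_normc; apply/eqP; rewrite eq_le normc_ge0 (le_trans (f0 x))// mul0r.
have -> : normc (mu f) = M * normc (mu (M^-1%:C%C *: f)).
  rewrite cmeasureZ normcM normc_real ger0_norm ?invr_ge0 ?(ltW M0)//.
  by rewrite mulrA divff ?mul1r// gt_eqF.
rewrite EFinM lee_pmul2l//.
apply: upper_integral_ge => h lh Bh; apply: normc_le_var_sup => x.
apply: le_trans (Bh x); rewrite lee_fin Cc_scaleE normcM normc_real.
by rewrite ger0_norm ?invr_ge0 ?(ltW M0)// mulrC ler_pdivrMr// mulrC.
Qed.

Lemma le_variation mu (A B : set G) : A `<=` B -> (variation mu A <= variation mu B)%E.
Proof.
move=> AB; apply: le_upper_integral => x; rewrite lee_fin !indicE ler_nat.
by have [/[!inE]/AB xB|//] := boolP (x \in A); rewrite mem_set.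
Qed.

Lemma variation_ge0 mu (A : set G) : (0 <= variation mu A)%E.
Proof. by apply: upper_integral_ge0 => x; rewrite lee_fin indicE ler0n. Qed.

Lemma variationU mu (A B : set G) :
  (variation mu (A `|` B) <= variation mu A + variation mu B)%E.
Proof.
have i0 (D : set G) x : (0%:E <= (\1_D x)%:E :> \bar R)%E by rewrite lee_fin indicE ler0n.
apply: le_trans (upper_integralD mu (i0 A) (i0 B)).
apply: le_upper_integral => x; rewrite -EFinD lee_fin !indicE in_setU.
by case: (x \in A) (x \in B) => [] []; rewrite ?addr0 ?add0r// lerDl.
Qed.

(** For two approximating sequences, the modulus of mu (u n - v n) is at most the upper integral of
    |F - u n| + |F - v n|, which subadditivity makes small. *)
Lemma has_integral_unique mu (F : G -> C) z w :
  has_integral mu F z -> has_integral mu F w -> z = w.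
Proof.
move=> [u [Fu uz]] [v [Fv vw]].
have uw : (mu (u n) : C) @[n --> \oo] --> (w : C).
  apply/cvg_normcP => e e0.
  have e20 : 0 < e / 2 by rewrite divr_gt0.
  have e40 : 0 < e / 2 / 2 by rewrite divr_gt0.
  have /cvg_normcP/(_ _ e20) vwe := vw.
  have Fue := cvge0_lt _ Fu e40; have Fve := cvge0_lt _ Fv e40.
  near=> n.
  rewrite (le_lt_trans (normc_dist_triangle (mu (v n)) _ _))// [ltRHS]splitr.
  rewrite ltrD//; last by near: n.
  rewrite -cmeasureB -lte_fin.
  apply: le_lt_trans (normc_le_upper_integral mu _) _.
  have Fu0 x : (0%:E <= (normc (F x - u n x))%:E)%E by rewrite lee_fin normc_ge0.
  have Fv0 x : (0%:E <= (normc (F x - v n x))%:E)%E by rewrite lee_fin normc_ge0.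
  apply: (@le_lt_trans _ _ (upper_integral mu
      (fun x => (normc (F x - u n x))%:E + (normc (F x - v n x))%:E)%E)).
    apply: le_upper_integral => x; rewrite -EFinD lee_fin Cc_addE Cc_oppE.
    by rewrite (le_trans (normc_dist_triangle (F x) _ _))// lerD2r normc_distC.
  apply: le_lt_trans (upper_integralD mu Fu0 Fv0) _.
  by rewrite (splitr (e / 2)) EFinD lteD//; near: n; [exact: Fue|exact: Fve].
exact: normc_cvg_unique uz uw.
Unshelve. all: by end_near. Qed.

Lemma integralE mu (F : G -> C) z : has_integral mu F z -> integral mu F = z.
Proof.
move=> Fz; rewrite /integral; case: xgetP => [w _ Fw|/(_ z)//].
exact: has_integral_unique Fw Fz.
Qed.

Lemma upper_integral0 mu : upper_integral mu (fun=> 0%E) = 0%E.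
Proof.
apply/eqP; rewrite eq_le; apply/andP; split; last exact: upper_integral_ge0.
apply: (@le_trans _ _ (var_sup mu (fun=> 0%E))).
  apply: upper_integral_le => //.
  by apply: (@lower_semicontinuous_EFin R G (fun=> 0)) => x; exact: cvg_cst.
apply: var_sup_le => g g0; have -> : g = 0.
  by apply/val_inj/funext => x; apply: eq0_normc; apply/eqP;
    rewrite eq_le normc_ge0 andbT -lee_fin; exact: g0.
by rewrite raddf0 normc0.
Qed.

Lemma variation0 mu : variation mu set0 = 0%E.
Proof.
rewrite -(upper_integral0 mu); congr upper_integral; apply/funext => x.
by rewrite indicE in_set0.
Qed.

Lemma integral_Cc mu f : integral mu f = mu f.
Proof.
apply: integralE; exists (fun=> f); split; last exact: cvg_cst.
rewrite (_ : (fun _ : nat => _) = (fun=> 0%E)); first exact: cvg_cst.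
apply/funext => n; rewrite -(upper_integral0 mu); congr upper_integral.
by apply/funext => x; rewrite subrr normc0.
Qed.

End upper_integral.

(** * Cutoffs of an open set *)

Section restriction.
Context {R : realType} {G : topologicalZmodType}.
Hypotheses (hausG : hausdorff_space G) (lcG : locally_compact [set: G]).
Local Notation C := (R[i]^o).
Local Notation Cc := (Cc R G).
Local Notation cmeasure := (cmeasure R G).
Implicit Types (mu nu : cmeasure) (f g : Cc) (A : set G).

(** The support may be non-compact: a cutoff only ever multiplies a test function, which supplies
    compactness. *)
Record cutoff A : Type := Cutoff {
  cutoff_fun :> G -> R ;
  cutoff_continuous : continuous cutoff_fun ;
  cutoff_ge0 : forall x, 0 <= cutoff_fun x ;
  cutoff_le_indic : forall x, cutoff_fun x <= \1_A x }.

Definition cut A (w : cutoff A) f : Cc := scale_real hausG (@cutoff_continuous A w) f.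

(** The filter of sections of the directed set of cutoffs, so that a limit along it is a limit of a
    net indexed by cutoffs, the same net for all measures and test functions. *)
Definition cutoff_filter A : set_system (cutoff A) :=
  filter_from setT (fun w : cutoff A => [set w' : cutoff A | forall x, w x <= w' x]).

Arguments cutoff_filter A : clear implicits.

Lemma cutoff0_le A x : (0 : R) <= \1_A x. Proof. by rewrite indicE ler0n. Qed.

Definition cutoff0 A : cutoff A :=
  Cutoff (fun x => cvg_cst (0 : R) : {for x, continuous (fun=> 0 : R)})
    (fun x => lexx 0) (cutoff0_le A).

Lemma cutoff_max_subproof A (v w : cutoff A) :
  [/\ continuous (fun x => Num.max (v x) (w x)),
      (forall x, 0 <= Num.max (v x) (w x)) &
      (forall x, Num.max (v x) (w x) <= \1_A x)].
Proof.
split=> x.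
- exact: (@continuous_max R G v w x (@cutoff_continuous _ v x) (@cutoff_continuous _ w x)).
- by rewrite le_max cutoff_ge0.
- by rewrite ge_max !cutoff_le_indic.
Qed.

Definition cutoff_max A (v w : cutoff A) : cutoff A :=
  let: And3 c p l := cutoff_max_subproof v w in Cutoff c p l.

Lemma cutoff_maxE A (v w : cutoff A) x : cutoff_max v w x = Num.max (v x) (w x).
Proof. by rewrite /cutoff_max; case: cutoff_max_subproof. Qed.

Global Instance cutoff_filter_proper A : ProperFilter (cutoff_filter A).
Proof.
apply: filter_from_proper; last by move=> w _; exists w => x /=.
apply: filter_from_filter; first by exists (cutoff0 A).
move=> v w _ _; exists (cutoff_max v w) => // u /= vwu; split=> x /=;
  by have := vwu x; rewrite cutoff_maxE ge_max => /andP[].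
Qed.

Lemma normc_cut A (w : cutoff A) f x : normc (cut w f x) = w x * normc (f x).
Proof. by rewrite /= normcM normc_real ger0_norm// cutoff_ge0. Qed.

Lemma cutoff_le1 A (w : cutoff A) x : w x <= 1.
Proof. by rewrite (le_trans (cutoff_le_indic w x))// indicE lern1 leq_b1. Qed.

Lemma normc_cut_le A (w : cutoff A) f x : normc (cut w f x) <= normc (f x).
Proof. by rewrite normc_cut ler_piMl ?normc_ge0 ?cutoff_le1. Qed.

Lemma supp_cut A (w : cutoff A) f : supp (cut w f) `<=` supp f.
Proof.
apply: supp_sub => //; first exact: compact_supp.
by move=> x; rewrite mulf_eq0 negb_or => /andP[_]; exact: supp_neq0.
Qed.

Lemma cut_linear A (w : cutoff A) : linear (cut w).
Proof.
move=> a f g; apply/val_inj/funext => x.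
change ((w x)%:C%C * (a * f x + g x) = a * ((w x)%:C%C * f x) + (w x)%:C%C * g x).
by rewrite mulrDr mulrCA.
Qed.

Lemma normc_cut_bounded mu A f : exists M : R, forall w : cutoff A, normc (mu (cut w f)) <= M.
Proof.
have [c c0 cP] := cmeasure_bounded mu (@compact_supp _ _ f).
exists (c * supnorm f) => w; rewrite (le_trans (cP _ (@supp_cut A w f)))//.
rewrite ler_pM2l//; apply: supnorm_le => x.
exact: le_trans (normc_cut_le w f x) (normc_le_supnorm f x).
Qed.

(** Take [u] below 1_A |f| with |mu u| almost the supremum [V], and let [w] be |u| / d truncated at
    1. Then w u is uniformly close to [u], so |mu (w u)| still nearly exhausts [V], and
    superadditivity leaves little for the residual. *)
Lemma cut_residual_small mu A f (e : R) : open A -> 0 < e -> exists w : cutoff A,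
  (var_sup mu (fun x => ((\1_A x - w x) * normc (f x))%:E) <= e%:E)%E.
Proof.
move=> oA e0.
have [c c0 cP] := cmeasure_bounded mu (@compact_supp _ _ f).
pose V := var_sup mu (fun x => (\1_A x * normc (f x))%:E).
have i0 x : 0 <= \1_A x * normc (f x) by rewrite mulr_ge0 ?cutoff0_le ?normc_ge0.
have V0 : (0 <= V)%E by apply: var_sup_ge0 => x; rewrite lee_fin.
have supp_le (u : Cc) : (forall x, (normc (u x))%:E <= (\1_A x * normc (f x))%:E)%E ->
    supp u `<=` supp f.
  move=> uf; apply: supp_sub => //; first exact: compact_supp.
  move=> x; apply: contra_neqP => /supp_eq0 fx; apply: eq0_normc; apply/eqP.
  by have := uf x; rewrite fx normc0 mulr0 lee_fin eq_le normc_ge0 andbT.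
have VM : (V <= (c * supnorm f)%:E)%E.
  apply: var_sup_le => u uf; rewrite lee_fin (le_trans (cP _ (supp_le _ uf)))//.
  rewrite ler_pM2l//; apply: supnorm_le => x.
  have := uf x; rewrite lee_fin => /le_trans; apply.
  by rewrite (le_trans _ (normc_le_supnorm f x))// ler_piMl ?normc_ge0.
have Vfin : V \is a fin_num by rewrite ge0_fin_numE// (le_lt_trans VM)// ltry.
have e20 : 0 < e / 2 by rewrite divr_gt0.
have [_ [u uf <-] Vu] := ub_ereal_sup_adherent e20 Vfin.
(* On the support of [f], a change of sup norm at most [d] alters [mu] by at most c d = e / 2. *)
pose d := e / 2 / c; have d0 : 0 < d by rewrite divr_gt0.
have cw : continuous (fun x => Num.min 1 (normc (u x) / d)).
  move=> x; apply: (@continuous_min R G (fun=> 1) (fun x => normc (u x) / d)).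
    exact: cvg_cst.
  by apply: cvgMl; exact: (continuous_normc (@Cc_continuous _ _ u)).
have w0 x : 0 <= Num.min 1 (normc (u x) / d).
  by rewrite le_min ler01/= divr_ge0 ?normc_ge0// ltW.
(* Off [A] the bound on [u] forces u x = 0, so the truncation vanishes there. *)
have w1 x : Num.min 1 (normc (u x) / d) <= \1_A x.
  rewrite indicE; have [_|/negP xA] := boolP (x \in A); first by rewrite ge_min lexx.
  have := uf x; rewrite indicE memNset ?mul0r; last by move=> /mem_set.
  by rewrite lee_fin ge_min ler_pdivrMr// mul0r => ->; rewrite orbT.
exists (Cutoff cw w0 w1); set w := Cutoff cw w0 w1.
(* w u is dominated by w |f|, and w |f| + (1_A - w) |f| is the function 1_A |f| that defines [V]. *)
have key : ((normc (mu (cut w u)))%:E +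
    var_sup mu (fun x => ((\1_A x - w x) * normc (f x))%:E) <= V)%E.
  have cuth x : ((normc (cut w u x))%:E <= (w x * normc (f x))%:E)%E.
    rewrite lee_fin normc_cut; apply: ler_wpM2l; first exact: w0.
    have := uf x; rewrite lee_fin => /le_trans; apply.
    by rewrite ler_piMl ?normc_ge0.
  apply: le_trans (var_sup_superadd mu _ cuth) _.
  by apply: le_var_sup => x; rewrite -EFinD -mulrDl addrC subrK.
have diff : normc (mu u) <= normc (mu (cut w u)) + e / 2.
  rewrite -lerBlDl (le_trans (ler_norm _))// (le_trans (ler_dist_normc _ _))//.
  rewrite -cmeasureB (le_trans (cP _ _))//.
    apply: supp_sub => //; first exact: compact_supp.
    move=> x uwx; apply: (supp_le u uf); apply: supp_neq0.
    apply: contra_neq uwx => ux.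
    by rewrite Cc_addE Cc_oppE /= ux mulr0 subr0.
  rewrite mulrC -ler_pdivlMr//; apply: supnorm_le => x.
  rewrite Cc_addE Cc_oppE.
  have -> : u x - cut w u x = (1 - w x)%:C%C * u x by rewrite raddfB/= mulrBl mul1r.
  rewrite normcM normc_real ger0_norm ?subr_ge0 ?cutoff_le1//= /w /=.
  (* Where |u| >= d the cutoff equals 1 and nothing is lost; elsewhere |u| itself is at most [d]. *)
  have [du|/ltW ud] := leP d (normc (u x)).
    have m1 : 1 <= normc (u x) / d by rewrite ler_pdivlMr ?mul1r.
    by rewrite (min_l m1) subrr mul0r (ltW d0).
  by rewrite (le_trans _ ud)// ler_piMl ?normc_ge0// gerBl.
have V1 : V = (fine V)%:E by rewrite fineK.
have {}Vu : (V - (e / 2)%:E < (normc (mu u))%:E)%E := Vu.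
rewrite V1 -EFinB lte_fin in Vu; rewrite V1 in key.
rewrite -leeBrDl// -EFinB in key.
apply: le_trans key _; rewrite lee_fin lerBlDr.
by move: Vu diff; rewrite [in X in _ -> _ -> X](splitr e); lra.
Qed.

End restriction.

(** * Restriction to an open set *)

Section restriction_cvg.
Context {R : realType} {G : topologicalZmodType}.
Hypotheses (hausG : hausdorff_space G) (lcG : locally_compact [set: G]).
Local Notation C := (R[i]^o).
Local Notation Cc := (Cc R G).
Local Notation cmeasure := (cmeasure R G).
Local Notation cut := (cut hausG).
Implicit Types (mu nu : cmeasure) (f g : Cc) (A : set G).

Lemma normc_indic_cut A (w : cutoff A) f x :
  normc ((\1_A x : C) * f x - cut w f x) = (\1_A x - w x) * normc (f x).
Proof.
have -> : (\1_A x : C) = (\1_A x : R)%:C%C by rewrite !indicE; case: (x \in A).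
rewrite /= -mulrBl -raddfB normcM normc_real ger0_norm// subr_ge0.
exact: cutoff_le_indic.
Qed.

Lemma cut_residual_near mu A f (e : R) : open A -> 0 < e ->
  \forall w \near @cutoff_filter R G A,
  (var_sup mu (fun x => ((\1_A x - cutoff_fun w x) * normc (f x))%:E) <= e%:E)%E.
Proof.
move=> oA e0; have [w we] := cut_residual_small hausG mu f oA e0.
exists w => // w' /= ww'; apply: le_trans we; apply: le_var_sup => x.
by rewrite lee_fin ler_wpM2r ?normc_ge0// lerD2l lerN2.
Qed.

(** The Cauchy estimate along the cutoffs: (w' - w) f is dominated by the residual of the smaller
    cutoff. *)
Lemma cut_dist mu A f (w w' : cutoff A) : (forall x, w x <= w' x) ->
  ((normc (mu (cut w' f) - mu (cut w f)))%:E <=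
   var_sup mu (fun x => ((\1_A x - w x) * normc (f x))%:E))%E.
Proof.
move=> ww'; rewrite -cmeasureB; apply: normc_le_var_sup => x.
rewrite lee_fin Cc_addE Cc_oppE /= -mulrBl -raddfB normcM normc_real.
rewrite ger0_norm ?subr_ge0// ler_wpM2r ?normc_ge0// lerD2r.
exact: cutoff_le_indic.
Qed.

(** An ultrafilter finer than the cutoff filter yields a candidate [z] by boundedness; the Cauchy
    estimate then gives convergence along the whole filter. *)
Lemma cut_cvg mu A f : open A ->
  exists z : C, (mu (cut w f) : C) @[w --> @cutoff_filter R G A] --> z.
Proof.
move=> oA; have [M fM] := normc_cut_bounded hausG mu A f.
have [U [UF sU]] := ultraFilterLemma (@cutoff_filter_proper R G A).
have [z zU] := @ultra_cvg_normc_bounded _ _ U (fun w => mu (cut w f)) M UF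
  (filterE _ fM).
exists z; apply/cvg_normcP => e e0.
have e20 : 0 < e / 2 by rewrite divr_gt0.
have [w _ we] := cut_residual_near mu f oA e20.
exists w => // w' /we {}w'e.
rewrite normc_distC (@le_lt_trans _ _ (e / 2))//; last first.
  by rewrite ltr_pdivrMr// ltr_pMr// ltr1n.
(* The cutoffs above [w'] form a set of the ultrafilter, so the uniform estimate on them passes to
   [z]. *)
apply: (normc_le_cvg _ zU); apply: sU; exists w' => // v /= w'v.
by rewrite -lee_fin; apply: le_trans (cut_dist mu f w'v) w'e.
Qed.

Lemma cvge0_squeeze (u : nat -> \bar R) :
  (forall n, (0 <= u n <= (n.+1%:R^-1)%:E)%E) -> u @ \oo --> 0%E.
Proof.
move=> un; apply: (@squeeze_cvge _ _ _ _ (fun=> 0%E) _ (fun n => (n.+1%:R^-1)%:E)).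
- exact: nearW.
- exact: cvg_cst.
- by apply: cvg_EFin; [exact: nearW|exact: cvg_harmonic].
Qed.

(** Cutoffs with residual at most 1 / (n + 1) give test functions tending to 1_A f in the seminorm
    of L^1(|mu|); they are chosen so that the values of [mu] tend to [z] as well. *)
Lemma has_integral_cut mu A f (z : C) : open A ->
  (mu (cut w f) : C) @[w --> @cutoff_filter R G A] --> z ->
  has_integral mu (fun x => \1_A x * f x) z.
Proof.
move=> oA /cvg_normcP fz.
have /choice[w wP] n : exists w : cutoff A,
    (var_sup mu (fun x => ((\1_A x - w x) * normc (f x))%:E) <= (n.+1%:R^-1)%:E)%E /\
    normc (mu (cut w f) - z) < n.+1%:R^-1.
  have n0 : 0 < n.+1%:R^-1 :> R by rewrite invr_gt0.
  have [w wn] := filter_ex (filterI (cut_residual_near mu f oA n0) (fz _ n0)).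
  by exists w.
exists (fun n => cut (w n) f); split.
  apply: cvge0_squeeze => n; apply/andP; split.
    by apply: upper_integral_ge0 => x; rewrite lee_fin normc_ge0.
  apply: le_trans (wP n).1; apply: upper_integral_le; last first.
    by move=> x; rewrite normc_indic_cut.
  (* As [w n] vanishes off [A], the error is 1_A times a continuous nonnegative function; being
     lower semicontinuous, it serves as its own majorant. *)
  rewrite (_ : (fun _ => _) = (fun x => (\1_A x * ((1 - w n x) * normc (f x)))%:E)).
    apply: lower_semicontinuous_indic => //.
      move=> x; apply: cvgM; last exact: (continuous_normc (@Cc_continuous _ _ f)).
      by apply: cvgB; [exact: cvg_cst|exact: cutoff_continuous].
    by move=> x; rewrite mulr_ge0 ?normc_ge0// subr_ge0 cutoff_le1.
  apply/funext => x; rewrite mulrA; congr ((_ * _)%:E).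
  have := cutoff_le_indic (w n) x; have := cutoff_ge0 (w n) x.
  rewrite indicE; case: (x \in A) => /=; first by rewrite mul1r.
  by rewrite mul0r sub0r => w0 w1; apply/eqP; rewrite oppr_eq0 eq_le w1 w0.
apply/cvg_normcP => e e0; near=> n.
apply: (lt_trans (wP n).2); near: n.
exact: (@near_infty_natSinv_lt R (PosNum e0)).
Unshelve. all: by end_near. Qed.

(** Linearity and the local bounds of [mu] survive the limit over cutoffs, since |w f| <= |f|. Hence
    the functional behind [restriction] is a measure, and the default 0 does not occur. *)
Lemma restriction_cvg mu A f : open A ->
  (mu (cut w f) : C) @[w --> @cutoff_filter R G A] --> (restriction mu A f : C).
Proof.
move=> oA; rewrite /restriction /to_cmeasure.
have int g : (mu (cut w g) : C) @[w --> @cutoff_filter R G A] -->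
    (integral mu (fun x => \1_A x * g x) : C).
  by have [z gz] := cut_cvg mu g oA; rewrite (integralE hausG lcG (has_integral_cut oA gz)).
suff H : (fun g : Cc => integral mu (fun x => \1_A x * g x)) \in @cmeasure_pred R G.
  by move: (insubdK (0 : cmeasure) H) => /= ->; exact: int.
apply/asboolP; split.
  move=> a g h; apply: normc_cvg_unique (int _) _.
  rewrite (_ : (fun w => _) = (fun w : cutoff A => a *: (mu (cut w g) : C) + mu (cut w h))).
    by apply: cvgD; [apply: cvgZr; exact: int|exact: int].
  by apply/funext => w; rewrite cut_linear cmeasure_linear.
move=> K cK; have [c c0 cP] := cmeasure_bounded mu cK; exists c => // g gK.
rewrite -[integral _ _]subr0; apply: (normc_le_cvg _ (int g)).
apply: nearW => w; rewrite subr0 (le_trans (cP _ _))//.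
  by move=> x /(@supp_cut R G hausG)/gK.
rewrite ler_pM2l//; apply: supnorm_le => x.
by rewrite (le_trans (normc_cut_le hausG w g x))// normc_le_supnorm.
Qed.

(** The same cutoffs approximate all three restrictions, so linearity is that of limits along one
    filter. *)
Lemma restriction_linear A (a : R[i]) mu nu : open A ->
  restriction (a *: mu + nu) A = a *: restriction mu A + restriction nu A.
Proof.
move=> oA; apply/val_inj/funext => f.
apply: (@normc_cvg_unique R _ (@cutoff_filter R G A)
  (fun w => (a *: mu + nu) (cut w f))); first exact: restriction_cvg.
apply: (@cvgD _ _ _ _ _ (fun w => a *: (mu (cut w f) : C))).
  by apply: cvgZr; exact: restriction_cvg.
exact: restriction_cvg.
Qed.

Lemma normc_restriction_le mu A f (M : R) : open A ->
  (forall w : cutoff A, normc (mu (cut w f)) <= M) -> normc (restriction mu A f) <= M.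
Proof.
move=> oA fM.
have fM0 : \forall w \near @cutoff_filter R G A, normc (mu (cut w f) - 0) <= M.
  by apply: nearW => w; rewrite subr0.
have := normc_le_cvg (@cutoff_filter_proper R G A) (@restriction_cvg mu A f oA) fM0.
by rewrite subr0.
Qed.

Lemma normc_restriction_le_variation mu A (B : set G) f (M V : R) : open A -> 0 <= M ->
  (forall x, (\1_A x : R) * normc (f x) <= M * \1_B x) -> (variation mu B <= V%:E)%E ->
  normc (restriction mu A f) <= M * V.
Proof.
move=> oA M0 fM BV; apply: normc_restriction_le => // w.
rewrite -lee_fin EFinM; apply: (@le_trans _ _ (M%:E * variation mu B)%E).
  apply: normc_le_variation => // x; rewrite normc_cut.
  by apply: le_trans (fM x); rewrite ler_wpM2r ?normc_ge0// cutoff_le_indic.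
by rewrite lee_wpmul2l.
Qed.

Lemma restriction_eq0 mu A f : open A -> (forall x, A x -> f x = 0) ->
  restriction mu A f = 0.
Proof.
move=> oA f0; apply: eq0_normc; apply/eqP; rewrite eq_le normc_ge0 andbT.
apply: normc_restriction_le => // w; rewrite (_ : cut w f = 0) ?raddf0 ?normc0//.
apply/val_inj/funext => x; apply: eq0_normc; apply/eqP.
rewrite eq_le normc_ge0 andbT [normc _]normc_cut.
have := cutoff_le_indic w x; have := cutoff_ge0 w x.
rewrite indicE; have [/[!inE]/f0 ->|_] := boolP (x \in A); first by rewrite normc0 mulr0.
by move=> w0 w1; rewrite (_ : w x = 0) ?mul0r//; apply/eqP; rewrite eq_le w0 w1.
Qed.

End restriction_cvg.

(** * Convolution *)

Section convolution.
Context {R : realType} {G : topologicalZmodType}.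
Hypotheses (hausG : hausdorff_space G) (lcG : locally_compact [set: G]).
Local Notation C := (R[i]^o).
Local Notation Cc := (Cc R G).
Local Notation cmeasure := (cmeasure R G).
Implicit Types (mu nu rho tau : cmeasure) (f g : Cc) (A K L : set G).

Lemma compactB K L : compact K -> compact L ->
  compact [set x - y | x in K & y in L].
Proof.
move=> cK cL; have := compactD cK (compactN cL); congr (compact _).
apply/seteqP; split=> [_ [x Kx [_ [y Ly <-] <-]]|_ [x Kx [y Ly <-]]].
  by exists x => //; exists y.
by exists x => //; exists (- y) => //; exists y.
Qed.

(** For closed [L] this says that the support of [tau] lies in [L], without introducing the support
    of a measure. *)
Definition supported_in tau L := forall f, (forall x, L x -> f x = 0) -> tau f = 0.

Lemma restriction_supported mu A : open A ->
  supported_in (restriction mu A) (closure A).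
Proof.
by move=> oA f f0; apply: restriction_eq0 => // x Ax; apply/f0/subset_closure.
Qed.

Local Notation translate := (translate hausG).

(** The function vanishes off the compact set supp f - L. It is continuous because translates of [f]
    by nearby points are uniformly close and live in a common compact set, on which [tau] has one
    bound. *)
Lemma conv_fun_Cc tau L f : compact L -> supported_in tau L ->
  (fun x => tau (translate x f)) \in @Cc_pred R G.
Proof.
move=> cL tauL.
apply: (@Cc_intro _ _ hausG _ [set x - y | x in supp f & y in L]); last first.
- move=> x; apply: contra_neqP => nx; apply: tauL => y Ly /=.
  by apply: supp_eq0 => fxy; apply: nx; exists (x + y) => //; exists y; rewrite ?addrK.
- by apply: compactB => //; exact: compact_supp.
apply/continuous_normcP => x e e0.
have [W W0 cW] := locally_compact_nbhs lcG 0.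
(* For y - x in [W], the translates of [f] by [x] and by [y] both vanish off - x + S; for [x] this
   uses that 0 is in [W]. *)
pose S := [set s - w | s in supp f & w in W].
have cS : compact [set - x + s | s in S].
  by apply/compact_addl/compactB => //; exact: compact_supp.
have [c c0 cP] := cmeasure_bounded tau cS.
have d0 : 0 < e / 2 / c by rewrite !divr_gt0.
have : nbhs (- x + x) (W `&` [set v | forall y, normc (f (v + y) - f y) < e / 2 / c]).
  by rewrite addNr; apply: filterI => //; exact: Cc_uniform_continuous.
move=> /nbhs_addl; apply: filterS => y /= [Wyx fyx].
rewrite -cmeasureB (@le_lt_trans _ _ (e / 2))//; last first.
  by rewrite ltr_pdivrMr// ltr_pMr// ltr1n.
rewrite (le_trans (cP _ _))//.
  apply: supp_sub => // z; rewrite Cc_addE Cc_oppE /=; apply: contra_neqP => nz.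
  have z1 : ~ supp f (y + z).
    move=> sz; apply: nz; exists (y + z - (- x + y)); last first.
      by rewrite opprD opprK [x - y]addrC [y + z]addrC (addrA (z + y)) addrK [z + x]addrC addKr.
    by exists (y + z) => //; exists (- x + y).
  have z2 : ~ supp f (x + z).
    move=> sz; apply: nz; exists (x + z); last by rewrite addKr.
    exists (x + z) => //; exists 0; last by rewrite subr0.
    exact: nbhs_singleton.
  by rewrite (supp_eq0 z1) (supp_eq0 z2) subr0.
rewrite mulrC -ler_pdivlMr//; apply: supnorm_le => z.
rewrite Cc_addE Cc_oppE /=.
by have := fyx (x + z); rewrite [- x + y]addrC -[y - x + _]addrA addKr => /ltW.
Qed.

(* Junk value [0] unless [tau] is supported in a compact set. *)
Definition conv_Cc tau f : Cc := insubd (0 : Cc) (fun x => tau (translate x f)).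

Lemma conv_CcE tau L f x : compact L -> supported_in tau L ->
  conv_Cc tau f x = tau (translate x f).
Proof.
by move=> cL tauL; move: (insubdK (0 : Cc) (conv_fun_Cc f cL tauL)) => /(congr1 (@^~ x)).
Qed.

Lemma translate_linear x : linear (translate x : Cc -> Cc).
Proof. by move=> a f g; apply/val_inj. Qed.

(** Both integrals in [convolution] have test functions as integrands, so they are values of [tau]
    and [rho]. The composite is then linear and locally bounded, which excludes the default
    measure. *)
Lemma convolutionE rho tau L f : compact L -> supported_in tau L ->
  convolution rho tau f = rho (conv_Cc tau f).
Proof.
move=> cL tauL; rewrite /convolution /to_cmeasure.
have int g : integral rho (fun x => integral tau (fun y => g (x + y))) =
    rho (conv_Cc tau g).
  rewrite -(integral_Cc hausG lcG); congr integral; apply/funext => x.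
  by rewrite (conv_CcE _ _ cL tauL) -(integral_Cc hausG lcG).
suff H : (fun g : Cc => integral rho (fun x => integral tau (fun y => g (x + y))))
    \in @cmeasure_pred R G.
  by move: (insubdK (0 : cmeasure) H) => /= ->; exact: int.
apply/asboolP; split.
  move=> a g h; rewrite !int -cmeasure_linear; congr (rho _).
  apply/val_inj/funext => x.
  change (conv_Cc tau (a *: g + h) x = a * conv_Cc tau g x + conv_Cc tau h x).
  by rewrite !(conv_CcE _ _ cL tauL) translate_linear cmeasure_linear.
move=> K cK.
(* If [g] lives in [K], the outer function lives in K - L, and for [x] in K - L the function g (x +
   .) lives in K - (K - L). *)
have [c c0 cP] := cmeasure_bounded rho (compactB cK cL).
have [d d0 dP] := cmeasure_bounded tau (compactB cK (compactB cK cL)).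
exists (c * d); first exact: mulr_gt0.
move=> g gK; rewrite int (le_trans (cP _ _))//.
  apply: supp_sub; [exact: hausG|exact: compactB|].
  move=> x; rewrite (conv_CcE _ _ cL tauL); apply: contra_neqP => nx.
  apply: tauL => y Ly /=; apply: supp_eq0 => gxy; apply: nx.
  by exists (x + y); [exact: gK|exists y; rewrite ?addrK].
rewrite -mulrA ler_pM2l//; apply: supnorm_le => x; rewrite (conv_CcE _ _ cL tauL).
have [xKL|nx] := pselect ([set x - y | x in K & y in L] x); last first.
  rewrite (tauL (translate x g)) ?normc0 ?mulr_ge0 ?supnorm_ge0 ?(ltW d0)//.
  move=> y Ly /=; apply: supp_eq0 => gxy; apply: nx.
  by exists (x + y); [exact: gK|exists y; rewrite ?addrK].
rewrite (le_trans (dP _ _))//.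
  apply: supp_sub; [exact: hausG|apply: compactB => //; exact: compactB|].
  move=> y /= /supp_neq0/gK Kxy; exists (x + y) => //; exists x => //.
  by rewrite addrC addKr.
rewrite ler_pM2l//; apply: supnorm_le => y; exact: (normc_le_supnorm g (x + y)).
Qed.

Lemma convolution_linearl (a : R[i]) rho rho' tau L : compact L -> supported_in tau L ->
  convolution (a *: rho + rho') tau = a *: convolution rho tau + convolution rho' tau.
Proof.
move=> cL tauL; apply/val_inj/funext => f.
change (convolution (a *: rho + rho') tau f =
  a * convolution rho tau f + convolution rho' tau f).
by rewrite !(convolutionE _ _ cL tauL).
Qed.

Lemma convolution_linearr (a : R[i]) rho tau tau' L : compact L ->
  supported_in tau L -> supported_in tau' L ->
  convolution rho (a *: tau + tau') = a *: convolution rho tau + convolution rho tau'.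
Proof.
move=> cL tauL tauL'; apply/val_inj/funext => f.
have tauLL : supported_in (a *: tau + tau') L.
  move=> g g0; change (a * tau g + tau' g = 0).
  by rewrite tauL// tauL'// mulr0 addr0.
change (convolution rho (a *: tau + tau') f =
  a * convolution rho tau f + convolution rho tau' f).
transitivity (rho (conv_Cc (a *: tau + tau') f)); first exact: convolutionE tauLL.
transitivity (a * rho (conv_Cc tau f) + rho (conv_Cc tau' f)); last first.
  by congr (a * _ + _); apply/esym; [exact: convolutionE tauL|exact: convolutionE tauL'].
transitivity (rho (a *: conv_Cc tau f + conv_Cc tau' f)); last exact: cmeasure_linear.
congr (rho _); apply/val_inj/funext => x.
transitivity ((a *: tau + tau') (translate x f)); first exact: conv_CcE tauLL.
transitivity (a * tau (translate x f) + tau' (translate x f)); first by [].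
by congr (a * _ + _); apply/esym; [exact: conv_CcE tauL|exact: conv_CcE tauL'].
Qed.

Lemma normc_convolution_restriction_le mu nu A (B K : set G) f (V W : R) :
  open A -> open B -> compact (closure B) -> supp f `<=` K ->
  (forall t : G, (variation nu [set (t + x)%R | x in K] <= V%:E)%E) ->
  (variation mu A <= W%:E)%E ->
  normc (convolution (restriction mu A) (restriction nu B) f) <= V * W * supnorm f.
Proof.
move=> oA oB cB fK nuV muW.
have V0 : 0 <= V by rewrite -lee_fin (le_trans _ (nuV 0))// variation_ge0.
rewrite (convolutionE _ _ cB (@restriction_supported nu B oB)).
rewrite [leRHS]mulrC mulrA.
apply: (@normc_restriction_le_variation _ _ hausG lcG _ _ A) => //.
  by rewrite mulr_ge0 ?supnorm_ge0.
move=> x; rewrite indicE; have [xA|_] := boolP (x \in A); last by rewrite !mul0r mulr0.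
rewrite mul1r mulr1 (conv_CcE _ _ cB (@restriction_supported nu B oB)).
apply: (@normc_restriction_le_variation _ _ hausG lcG _ _ [set - x + y | y in K]) => //.
  exact: supnorm_ge0.
move=> y /=; rewrite !indicE; have [sxy|/supp_eq0 ->] := pselect (supp f (x + y)); last first.
  by rewrite normc0 mulr0 mulr_ge0 ?supnorm_ge0.
rewrite (@mem_set _ [set - x + y | y in K]); last by exists (x + y); [exact: fK|rewrite addKr].
rewrite mulr1 (le_trans _ (normc_le_supnorm f (x + y)))// ler_piMl ?normc_ge0//.
by rewrite lern1 leq_b1.
Qed.

End convolution.

(** * Separability of the space of test functions *)

Section separability.
Context {R : realType} {G : topologicalZmodType}.
Hypotheses (hausG : hausdorff_space G) (lcG : locally_compact [set: G]).
Hypothesis scG : @second_countable G.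
Local Notation C := (R[i]^o).
Local Notation Cc := (Cc R G).
Implicit Types (f g : Cc) (K : set G).

Lemma second_countable_enum : exists b : nat -> set G,
  forall (x : G) (V : set G), nbhs x V -> exists n, [/\ open (b n), b n x & b n `<=` V].
Proof.
have [B cB [Bopen Bnbhs]] := scG.
have /countable_injP[i inji] := cB.
exists (fun n => xget set0 [set V | B V /\ i V = n]) => x V /Bnbhs[W [BW Wx] WV].
exists (i W); suff -> : xget set0 [set V | B V /\ i V = i W] = W by split=> //; exact: Bopen.
case: xgetP => [W' _ [BW' iW']|/(_ W)[]//].
by apply: inji; rewrite ?inE.
Qed.

Definition grid (n : nat) (p : int * int) : C :=
  (p.1%:~R / n.+1%:R +i* (p.2%:~R / n.+1%:R))%C.

Lemma grid_approx n (z : C) : exists p, normc (z - grid n p) <= 2 / n.+1%:R.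
Proof.
have n0 : 0 < n.+1%:R :> R by rewrite ltr0n.
have key (x : R) : `|x - (Num.floor (x * n.+1%:R))%:~R / n.+1%:R| <= 1 / n.+1%:R.
  rewrite ler_pdivlMr// -[X in _ * X]gtr0_norm// -normrM mulrBl divfK ?gt_eqF//.
  have /andP[l u] := floor_itv (x * n.+1%:R).
  rewrite ger0_norm ?subr_ge0// lerBlDl ltW//.
  by rewrite -[X in _ + X]/(1%:~R) -intrD.
exists (Num.floor (complex.Re z * n.+1%:R), Num.floor (complex.Im z * n.+1%:R)).
rewrite (le_trans (normc_le_absD _))//.
rewrite (_ : 2 = 1 + 1 :> R)// mulrDl.
by have := lerD (key (complex.Re z)) (key (complex.Im z)); case: (z).
Qed.

(* Instead of constructing approximants, we pick a representative in each nonempty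
   class of test functions that are close to a given step function with values in
   a grid of the complex plane; there are only countably many such classes. *)
Definition step_approx (b : nat -> set G) (d : nat * seq (nat * (int * int))) : set Cc :=
  [set g | (forall p, p \in d.2 -> forall x, b p.1 x ->
              normc (g x - grid d.1 p.2) <= 3 / d.1.+1%:R) /\
           (forall x, (forall p, p \in d.2 -> ~ b p.1 x) -> g x = 0)].

Definition dense_seq (b : nat -> set G) (k : nat) : Cc :=
  if unpickle k is Some d then xget 0 (step_approx b d) else 0.

(** One sequence [D] serves all [f], and [K] is the same for all precisions [e]; a single constant
    of vague boundedness on [K] thus controls every approximation of [f]. *)
Lemma Cc_separable : exists D : nat -> Cc, forall f, exists2 K,
  compact K /\ supp f `<=` K & forall e : R, 0 < e -> exists k,
    supp (D k) `<=` K /\ forall x, normc (f x - D k x) <= e.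
Proof.
have [b bP] := second_countable_enum; exists (dense_seq b) => f.
have [W W0 cW] := locally_compact_nbhs lcG 0.
pose K := [set x + y | x in supp f & y in W].
have cK : compact K by apply: compactD => //; exact: compact_supp.
exists K.
  split=> // x fx; exists x => //; exists 0; last by rewrite addr0.
  exact: nbhs_singleton.
move=> e e0.
(* Both [f] and the chosen [D k] will be within 3 / (n + 1) of the same grid values, whence 6. *)
have [n ne] : exists n, 6 / n.+1%:R <= e.
  have [n _ /(_ n (leqnn n))] :=
    @near_infty_natSinv_lt R (PosNum (divr_gt0 e0 (ltr0Sn _ 5))).
  move=> /= /ltW ne; exists n.
  by rewrite mulrC -ler_pdivlMr.
have n0 : 0 < n.+1%:R^-1 :> R by rewrite invr_gt0.
pose J := [set j | [/\ open (b j), b j `<=` K &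
  exists z : C, forall y, b j y -> normc (f y - z) <= n.+1%:R^-1]].
(* The basic sets of index below [N] that lie in [J] increase with [N]; compactness says that some
   [N] suffices. *)
have [N _ Ncover] : \forall N \near \oo,
    supp f `<=` [set x | exists j, [/\ (j < N)%N, J j & b j x]].
  have /compact_near_coveringP : compact (supp f) by exact: compact_supp.
  apply=> x sx.
  have nx : nbhs x ([set y | W (- x + y)] `&` [set y | normc (f y - f x) < n.+1%:R^-1]).
    apply: filterI; last exact: normc_Cc_lt.
    by apply: nbhs_addl; rewrite addNr.
  have [j [bo bx bsub]] := bP x _ nx.
  exists (b j, [set N | (j < N)%N]).
    by split; [exact: open_nbhs_nbhs|exists j.+1].
  move=> [y N] [/= bjy jN]; exists j; split=> //; split=> //.
    move=> z /bsub[/= Wxz _]; exists x => //; exists (- x + z) => //.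
    by rewrite addNKr.
  by exists (f x) => z /bsub[_ /ltW].
have {}Ncover x : supp f x -> exists2 j, j \in [seq j <- iota 0 N | j \in J] & b j x.
  move=> /(Ncover N (leqnn N))[j [jN Jj bx]]; exists j => //.
  by rewrite mem_filter mem_iota mem_set.
set F := [seq j <- iota 0 N | j \in J] in Ncover.
have FJ j : j \in F -> J j by rewrite mem_filter => /andP[/set_mem].
(* The constant 3 is 1 for the oscillation of [f] around [z] on [b j] plus 2 for rounding [z] to the
   grid. *)
have /choice[q qP] j : exists p, j \in F -> forall y, b j y ->
    normc (f y - grid n p) <= 3 / n.+1%:R.
  have [jF|_] := boolP (j \in F); last by exists (0, 0).
  have [_ _ [z zP]] := FJ j jF; have [p pz] := grid_approx n z.
  exists p => _ y /zP fyz; rewrite (le_trans (normc_dist_triangle z _ _))//.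
  by rewrite -(nat1r 2) mulrDl mul1r lerD.
pose d := (n, [seq (j, q j) | j <- F]).
have fd : step_approx b d f.
  split=> [_ /mapP[j jF ->] x bx|x nb]; first exact: qP.
  apply: supp_eq0 => /Ncover[j jF bx]; apply: (nb (j, q j)) => //.
  by apply/mapP; exists j.
(* [f] itself shows that the class is nonempty, so [xget] returns a genuine member of it. *)
exists (pickle d); rewrite /dense_seq pickleK.
case: xgetP => [g _ [g1 g2]|/(_ f)//].
have gd x : ~ (exists2 j, j \in F & b j x) -> g x = 0.
  move=> nx; apply: g2 => _ /mapP[j jF ->] bx; apply: nx; by exists j.
split.
  apply: supp_sub => // x; apply: contra_neqP => nKx; apply: gd => -[j jF bx].
  by have [_ bK _] := FJ j jF; exact/nKx/bK.
move=> x; have [[j jF bx]|nx] := pselect (exists2 j, j \in F & b j x); last first.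
  rewrite gd// subr0 (_ : f x = 0) ?normc0 ?ltW//.
  by apply: supp_eq0 => /Ncover[j jF bx]; apply: nx; exists j.
apply: le_trans ne; rewrite (le_trans (normc_dist_triangle (grid n (q j)) _ _))//.
rewrite (natrD _ 3 3) mulrDl lerD ?qP//.
rewrite normc_distC; apply: (g1 (j, q j)) => //.
by apply/mapP; exists j.
Qed.

End separability.

(** * Vague sequential compactness *)

Section vague_compactness.
Context {R : realType} {G : topologicalZmodType}.
Hypotheses (hausG : hausdorff_space G) (lcG : locally_compact [set: G]).
Hypothesis scG : @second_countable G.
Local Notation C := (R[i]^o).
Local Notation Cc := (Cc R G).
Local Notation cmeasure := (cmeasure R G).
Implicit Types (f g : Cc) (K : set G).

(** The bound concerns large n only, since the van Hove property controls |mu|(A_n) only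
    eventually. *)
Definition vaguely_bounded (u : nat -> cmeasure) := forall K, compact K ->
  exists2 c : R, 0 < c & \forall n \near \oo,
    forall f, supp f `<=` K -> normc (u n f) <= c * supnorm f.

(** All test functions converge at once along the ultrafilter, without diagonal extraction, and the
    limit inherits linearity and the constants [c]. *)
Lemma ultra_vague_limit (U : set_system nat) (u : nat -> cmeasure) :
  UltraFilter U -> \oo `<=` U -> vaguely_bounded u ->
  exists theta : cmeasure, forall f, (u n f : C) @[n --> U] --> (theta f : C).
Proof.
move=> UU ooU ub.
have /choice[theta thetaP] f : exists l : C, (u n f : C) @[n --> U] --> l.
  have [c c0 cP] := ub (supp f) (@compact_supp _ _ f).
  apply: (@ultra_cvg_normc_bounded _ _ U (fun n => u n f) (c * supnorm f)).
  by apply: ooU; apply: filterS cP => n; exact.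
suff H : theta \in @cmeasure_pred R G by exists (MkCmeasure H).
apply/asboolP; split.
  move=> a f g.
  apply: (@normc_cvg_unique R _ U (fun n => u n (a *: f + g))) => //.
  rewrite (_ : (fun n => _) = (fun n => a *: (u n f : C) + u n g)).
    by apply: cvgD; [apply: cvgZr; exact: thetaP|exact: thetaP].
  by apply/funext => n; rewrite cmeasure_linear.
move=> K cK; have [c c0 cP] := ub K cK; exists c => // f fK.
have fb : \forall n \near U, normc (u n f - 0) <= c * supnorm f.
  by apply: ooU; apply: filterS cP => n /(_ f fK); rewrite subr0.
by have := normc_le_cvg (@ultra_proper _ _ UU) (thetaP f) fb; rewrite subr0.
Qed.

Lemma strictly_increasing_choice (P : nat -> nat -> Prop) :
  (forall j N, exists2 n, (N <= n)%N & P j n) ->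
  exists2 s : nat -> nat, {homo s : i j / (i < j)%N} & forall j, P j (s j).
Proof.
move=> ex.
have /choice[p pP] (jN : nat * nat) : exists n, (jN.2 <= n)%N /\ P jN.1 n.
  by have [n Nn Pn] := ex jN.1 jN.2; exists n.
pose s := fix s j := if j is i.+1 then p (j, (s i).+1) else p (0, 0)%N.
exists s; last by case=> [|j]; [exact: (pP (0, 0)%N).2|exact: (pP (j.+1, (s j).+1)).2].
apply: homo_ltn; first exact: ltn_trans.
by move=> j; exact: (pP (j.+1, (s j).+1)).1.
Qed.

(** The limit [theta] is fixed first, along an ultrafilter. Sets of the ultrafilter are nonempty, so
    there are indices at which the first members of the dense sequence have values close to [theta];
    the uniform bound spreads the convergence to every [f]. *)
Lemma vague_compactness (u : nat -> cmeasure) : vaguely_bounded u ->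
  exists2 s : nat -> nat, {homo s : i j / (i < j)%N} &
    exists theta, vague_cvg (u \o s) theta.
Proof.
move=> ub; have [U [UU ooU]] := ultraFilterLemma (eventually_filter).
have [theta thetaP] := ultra_vague_limit UU ooU ub.
have [D Dsep] := Cc_separable (R := R) hausG lcG scG.
have [j N|s sinc sP] := @strictly_increasing_choice (fun j n =>
    forall k, (k <= j)%N -> normc (u n (D k) - theta (D k)) < j.+1%:R^-1).
  have j0 : 0 < j.+1%:R^-1 :> R by rewrite invr_gt0.
  have nN : \forall n \near U, (N <= n)%N by apply: ooU; exists N.
  (* A filter is closed under finite intersections only, hence the restriction to the first [i]
     members of the sequence. *)
  have nk i : \forall n \near U, forall k, (k < i)%N ->
      normc (u n (D k) - theta (D k)) < j.+1%:R^-1.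
    elim: i => [|i IH]; first by apply: filterE.
    have /cvg_normcP/(_ _ j0) := thetaP (D i).
    apply: filterS2 IH => n IH ni k; rewrite ltnS leq_eqVlt => /predU1P[->//|].
    exact: IH.
  by have [n [Nn nP]] := filter_ex (filterI nN (nk j.+1)); exists n.
exists s => //; exists theta => f; apply/cvg_normcP => e e0.
have [K [cK fK] Ksep] := Dsep f.
have [c c0 cP] := ub K cK.
(* [c] turns a sup norm error e / 4 / c into e / 4; three such errors stay strictly below [e]. *)
have d0 : 0 < e / 4 / c by rewrite !divr_gt0.
have [k [kK kf]] := Ksep _ d0.
have fDK : supp (f - D k) `<=` K.
  apply: supp_sub => // x; apply: contra_neqP => nx.
  rewrite Cc_addE Cc_oppE !supp_eq0 ?subrr//; first by move/kK.
  by move/fK.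
have fDle : supnorm (f - D k) <= e / 4 / c.
  by apply: supnorm_le => x; rewrite Cc_addE Cc_oppE.
have small n : (forall g, supp g `<=` K -> normc (u n g) <= c * supnorm g) ->
    normc (u n f - u n (D k)) <= e / 4.
  move=> /(_ _ fDK); rewrite -cmeasureB => /le_trans; apply.
  by rewrite mulrC -ler_pdivlMr.
have thetasmall : normc (theta f - theta (D k)) <= e / 4.
  rewrite -cmeasureB.
  have fb : \forall n \near U, normc (u n (f - D k) - 0) <= e / 4.
    by apply: ooU; apply: filterS cP => n /small; rewrite subr0 cmeasureB.
  by have := normc_le_cvg (@ultra_proper _ _ UU) (thetaP (f - D k)) fb; rewrite subr0.
have sn n : (n <= s n)%N.
  by elim: n => // n IH; rewrite (leq_ltn_trans IH)// sinc.
have e40 : 0 < e / 4 by rewrite divr_gt0.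
have [N _ NP] := cP.
have [M _ MP] := @near_infty_natSinv_lt R (PosNum e40).
near=> n.
have nk : (k <= n)%N by near: n; exact: nbhs_infty_ge.
have nN : (N <= n)%N by near: n; exact: nbhs_infty_ge.
have nM : (M <= n)%N by near: n; exact: nbhs_infty_ge.
have usmall := small _ (NP (s n) (leq_trans nN (sn n))).
apply: (le_lt_trans (normc_dist_triangle (u (s n) (D k)) _ _)).
apply: (le_lt_trans (lerD usmall (normc_dist_triangle (theta (D k)) _ _))).
apply: (@lt_le_trans _ _ (e / 4 + (e / 4 + e / 4))); last lra.
rewrite ler_ltD// ltr_leD//; last by rewrite normc_distC.
exact: lt_trans (sP n k nk) (MP n nM).
Unshelve. all: by end_near. Qed.

End vague_compactness.

(** * Packing by translates and the mass bound *)

Section packing.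
Context {R : realType} {G : topologicalZmodType}.
Hypotheses (hausG : hausdorff_space G) (lcG : locally_compact [set: G]).
Local Notation cmeasure := (cmeasure R G).
Implicit Types (A K V : set G) (s : seq G) (t x y : G).

Definition translates K s : set G := [set y | exists2 t, t \in s & [set t + x | x in K] y].

Lemma translates_nil K : translates K [::] = set0.
Proof. by apply/seteqP; split=> // y []. Qed.

Lemma translates_cons K t s :
  translates K (t :: s) = [set t + x | x in K] `|` translates K s.
Proof.
apply/seteqP; split=> [y [u]|y [Kty|[u us Kuy]]].
- by rewrite inE => /predU1P[->|us] Kuy; [left|right; exists u].
- by exists t => //; rewrite mem_head.
- by exists u => //; rewrite inE us orbT.
Qed.

(** Near-covering directed by inclusion of finite lists: x + V is a neighbourhood of [x], covered by
    every list that contains [x]. *)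
Lemma compact_translates K V : compact K -> nbhs 0 V -> exists s, K `<=` translates V s.
Proof.
move=> /compact_near_coveringP cK V0.
pose F := filter_from [set: seq G] (fun s : seq G => [set s' : seq G | {subset s <= s'}]).
have FF : Filter F.
  apply: filter_from_filter; first by exists [::].
  move=> s s' _ _; exists (s ++ s') => // r /= ssr.
  by split=> u us; apply: ssr; rewrite mem_cat us ?orbT.
have [x Kx|s _ sK] := cK _ F (fun (s : seq G) x => translates V s x) FF.
  exists ([set y | V (- x + y)], [set s : seq G | x \in s]).
    split; first by apply: nbhs_addl; rewrite addNr.
    by exists [:: x] => // s /(_ x (mem_head _ _)).
  move=> [y s] [/= Vxy xs]; exists x => //; exists (- x + y) => //.
  by rewrite addNKr.
by exists s; exact: sK.
Qed.

Lemma variation_translates_le (mu : cmeasure) K (c : R) s :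
  (forall t, (variation mu [set (t + x)%R | x in K] <= c%:E)%E) ->
  (variation mu (translates K s) <= ((size s)%:R * c)%:E)%E.
Proof.
move=> muc; elim: s => [|t s IH]; first by rewrite translates_nil mul0r variation0.
rewrite translates_cons (le_trans (variationU hausG lcG _ _ _))//.
by rewrite -nat1r mulrDl mul1r EFinD leeD.
Qed.

(** Disjointness of each translate from the union of the later ones is the form that finite
    additivity consumes by induction on the list. *)
Fixpoint packed V s : Prop :=
  if s is t :: s' then [set t + x | x in V] `&` translates V s' = set0 /\ packed V s'
  else True.

(** If x + V meets t + V, then [x] lies in t + (V - V). *)
Lemma maximal_packed_cover A V s : (forall t, A t -> ~ packed V (t :: s)) -> packed V s ->
  A `<=` translates [set x - y | x in V & y in V] s.
Proof.
move=> max ps x Ax; apply: contrapT => nx; apply: (max x Ax); split=> //.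
apply/seteqP; split=> // y [[v Vv xv] [t ts [w Vw tw]]]; apply: nx.
exists t => //; exists (w - v); first by exists w => //; exists v.
by rewrite addrA tw -xv addrK.
Qed.

Lemma translation_bounded_real (mu : cmeasure) K : translation_bounded mu ->
  compact K -> exists2 c : R, 0 <= c &
    forall t, (variation mu [set (t + x)%R | x in K] <= c%:E)%E.
Proof.
move=> tbmu /tbmu; set S := ereal_sup _ => Soo.
have muS t : (variation mu [set (t + x)%R | x in K] <= S)%E.
  by apply: ereal_sup_ubound; exists t.
have S0 : (0 <= S)%E by apply: le_trans (variation_ge0 mu _) (muS 0).
exists (fine S); first exact: fine_ge0.
by move=> t; rewrite fineK ?muS// ge0_fin_numE.
Qed.

End packing.

Section haar.
Context {R : realType} {G : topologicalZmodType}.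
Hypotheses (hausG : hausdorff_space G) (lcG : locally_compact [set: G]).
Variable m : {measure set (borel G) -> \bar R}.
Hypothesis haar_m : is_haar m.
Local Notation cmeasure := (cmeasure R G).
Implicit Types (A K V : set G) (s : seq G) (t x y : G).

Lemma borel_open A : open A -> measurable (A : set (borel G)).
Proof. by move=> oA; apply: sub_sigma_algebra; exact: oA. Qed.

Lemma borel_closed A : closed A -> measurable (A : set (borel G)).
Proof.
by move=> cA; rewrite -[A]setCK; apply: measurableC; apply: borel_open; exact: closed_openC.
Qed.

Lemma borel_compact K : compact K -> measurable (K : set (borel G)).
Proof. by move=> /(compact_closed hausG)/borel_closed. Qed.

Lemma borel_translates K s : compact K -> measurable (translates K s : set (borel G)).
Proof.
move=> cK; elim: s => [|t s IH]; first by rewrite translates_nil; exact: measurable0.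
by rewrite translates_cons; apply: measurableU => //; apply: borel_compact; exact: compact_addl.
Qed.

Lemma haar_addl t K : compact K -> m [set t + x | x in K] = m K.
Proof. by move=> cK; apply: (haar_invariant haar_m); exact: borel_compact. Qed.

Lemma haar_translates_le K s : compact K ->
  (m (translates K s) <= (size s)%:R%:E * m K)%E.
Proof.
move=> cK; elim: s => [|t s IH]; first by rewrite translates_nil measure0 mul0e.
rewrite translates_cons.
have := @measureU2 _ _ _ m _ _ (borel_compact (@compact_addl G t K cK))
  (@borel_translates K s cK).
rewrite [X in (_ <= X + _)%E](haar_addl t cK) => /le_trans; apply.
rewrite /= -nat1r EFinD ge0_muleDl ?lee_fin//.
by rewrite mul1e leeD.
Qed.

Lemma haar_packed K s : compact K -> packed K s ->
  m (translates K s) = ((size s)%:R%:E * m K)%E.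
Proof.
move=> cK; elim: s => [_|t s IH [tsK ps]]; first by rewrite translates_nil measure0 mul0e.
rewrite translates_cons.
have := @measureU _ _ _ m _ _ (borel_compact (@compact_addl G t K cK))
  (@borel_translates K s cK) tsK.
rewrite [X in _ = (X + _)%E](haar_addl t cK) => ->.
rewrite /= [X in (_ + X)%E](IH ps) -nat1r EFinD ge0_muleDl ?lee_fin//.
by rewrite mul1e.
Qed.

(** Otherwise the precompact [A], covered by finitely many translates of [K], would be a null
    set. *)
Lemma haar_nbhs_gt0 A K : open A -> precompact A -> (0 < m A)%E -> compact K ->
  nbhs 0 K -> (0 < m K)%E.
Proof.
move=> oA pA mA cK K0; rewrite lt_neqAle measure_ge0 andbT; apply/eqP => mK.
have [s As] := compact_translates (eq_ind _ id pA _ (precompactE A)) K0.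
have : (m A <= m (translates K s))%E.
  apply: le_measure; rewrite ?inE; [exact: borel_open|exact: borel_translates|].
  by move=> x Ax; apply/As/subset_closure.
rewrite leNgt => /negP; apply.
by rewrite (le_lt_trans (haar_translates_le s cK))// -mK mule0.
Qed.

(** The part of the closure outside [A] is the first piece of the van Hove boundary; the work lies
    in the measurability of both pieces. *)
Lemma haar_thickening_le A K : open A -> compact K ->
  (m (closure [set (x + y)%R | x in A & y in K]) <= m A + m (van_hove_boundary K A))%E.
Proof.
move=> oA cK.
have mB : measurable (van_hove_boundary K A : set (borel G)).
  apply: measurableU.
    apply: measurableD; last exact: borel_open.
    by apply: borel_closed; exact: closed_closure.
  apply: measurableI; last by apply: borel_closed; exact: closed_closure.
  by apply: borel_closed; apply: closedB => //; exact: open_closedC.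
apply: le_trans (measureU2 m (borel_open oA) mB).
apply: le_measure; rewrite ?inE.
- by apply: borel_closed; exact: closed_closure.
- by apply: measurableU => //; exact: borel_open.
- move=> x Kx; have [Ax|nAx] := pselect (A x); [by left|right; left; by split].
Qed.

(** The closure of A + K is compact, hence measurable and of finite measure. This bounds the size of
    a packing with centres in [A], so a largest one exists. *)
Lemma variation_le_haar (mu : cmeasure) A K (c : R) : open A -> precompact A ->
  compact K -> nbhs 0 K -> (0 < m K)%E ->
  (forall t,
    (variation mu [set (t + z)%R | z in [set (x - y)%R | x in K & y in K]] <= c%:E)%E) ->
  (variation mu A <=
    (c / fine (m K))%:E * m (closure [set (x + y)%R | x in A & y in K]))%E.
Proof.
move=> oA pA cK K0 mK0 muc.
have mKfin : m K \is a fin_num.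
  by rewrite ge0_fin_numE ?measure_ge0//; exact: (haar_compact haar_m).
have fK0 : 0 < fine (m K) by rewrite fine_gt0// mK0 ltey_eq mKfin.
set T := closure _.
have cT : compact T.
  have cAK := compactD (eq_ind _ id pA _ (precompactE A)) cK.
  apply: subclosed_compact (cAK) _; first exact: closed_closure.
  have /closure_id -> := compact_closed hausG cAK.
  apply: closureS => _ [x Ax [y Ky <-]].
  by exists x; [exact: subset_closure|exists y].
have mTfin : m T \is a fin_num.
  by rewrite ge0_fin_numE ?measure_ge0//; exact: (haar_compact haar_m).
pose P (N : nat) := `[< exists s, [/\ size s = N, packed K s & forall t, t \in s -> A t] >].
have size_le s : packed K s -> (forall t, t \in s -> A t) ->
    (size s)%:R * fine (m K) <= fine (m T).
  move=> ps sA; rewrite -lee_fin EFinM !fineK// -haar_packed//.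
  apply: le_measure; rewrite ?inE; [exact: borel_translates|exact: borel_compact|].
  move=> _ [t /sA At [x Kx <-]]; apply: subset_closure.
  by exists t => //; exists x.
have exP : exists N, P N by exists 0%N; apply/asboolP; exists [::].
have ubP N : P N -> (N <= Num.truncn (fine (m T) / fine (m K)))%N.
  move=> /asboolP[s [<- ps sA]].
  have q0 : 0 <= fine (m T) / fine (m K) by rewrite divr_ge0 ?fine_ge0 ?measure_ge0.
  by rewrite truncn_ge_nat// ler_pdivlMr// size_le.
case: (ex_maxnP exP ubP) => N /asboolP[s [sN ps sA]] maxN.
have c0 : 0 <= c by rewrite -lee_fin (le_trans _ (muc 0))// variation_ge0.
have cov := @maximal_packed_cover G A K s.
apply: (@le_trans _ _ (variation mu (translates [set x - y | x in K & y in K] s))).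
  apply: le_variation; apply: cov => // t At pts.
  have : P N.+1.
    apply/asboolP; exists (t :: s); split=> //=; first by rewrite sN.
    by move=> u; rewrite inE => /predU1P[->//|]; exact: sA.
  by move=> /maxN; rewrite ltnn.
apply: (le_trans (variation_translates_le hausG lcG s muc)).
rewrite -(fineK mTfin) -EFinM lee_fin mulrC -mulrA ler_wpM2l//.
by rewrite mulrC ler_pdivlMr// size_le.
Qed.

Lemma van_hove_variation_le (mu : cmeasure) (A : nat -> set G) :
  translation_bounded mu -> van_hove m A ->
  exists2 W : R, 0 <= W &
    \forall n \near \oo, (variation mu (A n) <= (W * fine (m (A n)))%:E)%E.
Proof.
move=> tbmu vhA; have [K K0 cK] := locally_compact_nbhs lcG 0.
have mK0 := haar_nbhs_gt0 (van_hove_open vhA 0) (van_hove_precompact vhA 0)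
  (van_hove_gt0 vhA 0) cK K0.
have [c c0 muc] := translation_bounded_real tbmu (compactB cK cK).
(* Once the boundary for this [K] has measure at most |A_n|, the closure of A_n + K has measure at
   most 2 |A_n|. *)
exists (2 * (c / fine (m K))).
  by rewrite mulr_ge0// divr_ge0// fine_ge0// measure_ge0.
have : \forall n \near \oo, (m (van_hove_boundary K (A n)) / m (A n) < 1%:E)%E.
  exact: (cvge0_lt _ (van_hove_lim vhA cK)).
apply: filterS => n bn.
have mAfin : m (A n) \is a fin_num.
  rewrite ge0_fin_numE ?measure_ge0//.
  apply: (@le_lt_trans _ _ (m (closure (A n)))).
    apply: le_measure; rewrite ?inE; [by apply: borel_open; exact: van_hove_open vhA _| |].
      by apply: borel_closed; exact: closed_closure.
    exact: subset_closure.
  apply: (haar_compact haar_m).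
  by have := van_hove_precompact vhA n; rewrite precompactE.
have mA0 : 0 < fine (m (A n)) by rewrite fine_gt0// (van_hove_gt0 vhA)/= ltey_eq mAfin.
have bA : (m (van_hove_boundary K (A n)) <= m (A n))%E.
  have V0 : 0 < (fine (m (A n)))^-1 by rewrite invr_gt0.
  move: bn; rewrite -[X in (_ / X)%E](fineK mAfin) inver gt_eqF//.
  rewrite -(divff (lt0r_neq0 mA0)) EFinM lte_pmul2r// fineK//.
  exact: ltW.
apply: le_trans (variation_le_haar (van_hove_open vhA n) (van_hove_precompact vhA n)
  cK K0 mK0 muc) _.
apply: (@le_trans _ _ ((c / fine (m K))%:E * (m (A n) + m (A n)))%E).
  rewrite lee_wpmul2l ?lee_fin ?divr_ge0 ?fine_ge0 ?measure_ge0//.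
  by rewrite (le_trans (haar_thickening_le (van_hove_open vhA n) cK))// leeD2l.
rewrite -(fineK mAfin) -EFinD -EFinM lee_fin -mulr2n -[_ *+ 2]mulr_natl.
by rewrite mulrCA mulrA.
Qed.

End haar.

(** * Eberlein convolutions *)

Section tilde.
Context {R : realType} {G : topologicalZmodType}.
Local Notation C := (R[i]^o).
Local Notation Cc := (Cc R G).
Local Notation cmeasure := (cmeasure R G).
Implicit Types (mu nu : cmeasure) (f : Cc) (K B : set G) (h : G -> \bar R).

Lemma tilde_linear (a : R[i]) mu nu : tilde (a *: mu + nu) = a^* *: tilde mu + tilde nu.
Proof.
apply/val_inj/funext => f.
change ((a * mu (tilde_Cc f) + nu (tilde_Cc f))^* =
  a^* * (mu (tilde_Cc f))^* + (nu (tilde_Cc f))^*).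
by rewrite rmorphD rmorphM.
Qed.

Lemma var_sup_tilde_le mu h : (var_sup (tilde mu) h <= var_sup mu (h \o -%R))%E.
Proof.
apply: var_sup_le => g gh; rewrite [tilde mu g]/((mu (tilde_Cc g))^*) normc_conj.
by apply: normc_le_var_sup => x; rewrite /= /tilde_fun normc_conj.
Qed.

(** Reflection carries lower semicontinuous majorants of the indicator of - B to those of [B], and
    conjugation preserves moduli. *)
Lemma variation_tilde_le mu B : (variation (tilde mu) B <= variation mu (-%R @` B))%E.
Proof.
apply: upper_integral_ge => h lh Bh.
apply: (@le_trans _ _ (var_sup (tilde mu) (h \o -%R))).
  apply: upper_integral_le => [x a /= /lh[V xV Vh]|x].
    by exists (-%R @^-1` V); [exact: opp_continuous|move=> y /Vh].
  apply: le_trans (Bh (- x)); rewrite lee_fin !indicE ler_nat.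
  by have [/[!inE] Bx|//] := boolP (x \in B); rewrite mem_set//; exists x.
apply: le_trans (var_sup_tilde_le _ _) _.
by apply: le_var_sup => x; rewrite /= opprK.
Qed.

Lemma translation_bounded_tilde mu : translation_bounded mu ->
  translation_bounded (tilde mu).
Proof.
move=> tbmu K /compactN/tbmu; apply: le_lt_trans.
apply: ge_ereal_sup => _ [t _ <-]; apply: le_trans (variation_tilde_le _ _) _.
apply: ereal_sup_ubound; exists (- t) => //; congr variation.
apply/seteqP; split=> [_ [_ [x Kx <-] <-]|_ [_ [x Kx <-] <-]].
  by exists (t + x); [exists x|rewrite opprD].
by exists (- x); [exists x|rewrite opprD].
Qed.

End tilde.

Section subsequences.
Context {R : realType} {G : topologicalZmodType}.
Hypotheses (hausG : hausdorff_space G) (lcG : locally_compact [set: G]).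
Hypothesis scG : @second_countable G.
Local Notation C := (R[i]^o).
Local Notation Cc := (Cc R G).
Local Notation cmeasure := (cmeasure R G).
Implicit Types (u v : nat -> cmeasure) (theta eta : cmeasure) (s : nat -> nat).

Lemma cvg_strictly_increasing s : {homo s : i j / (i < j)%N} -> s @ \oo --> \oo.
Proof.
move=> sinc.
have sn n : (n <= s n)%N by elim: n => // n IH; rewrite (leq_ltn_trans IH)// sinc.
by move=> P [N _ NP]; exists N => // n /= Nn; apply: NP; exact: leq_trans Nn (sn n).
Qed.

Lemma vague_cvg_subseq u theta s : {homo s : i j / (i < j)%N} ->
  vague_cvg u theta -> vague_cvg (u \o s) theta.
Proof.
move=> sinc utheta f; apply: cvg_comp (utheta f).
exact: cvg_strictly_increasing.
Qed.

Lemma vaguely_bounded_subseq u s : {homo s : i j / (i < j)%N} ->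
  vaguely_bounded u -> vaguely_bounded (u \o s).
Proof.
move=> sinc ub K /ub[c c0 cP]; exists c => //.
exact: (cvg_strictly_increasing sinc cP).
Qed.

Lemma vague_compactness2 u v : vaguely_bounded u -> vaguely_bounded v ->
  exists2 s, {homo s : i j / (i < j)%N} &
    (exists theta, vague_cvg (u \o s) theta) /\ (exists eta, vague_cvg (v \o s) eta).
Proof.
move=> ub vb; have [s sinc [theta us]] := vague_compactness hausG lcG scG ub.
have [r rinc [eta vsr]] := vague_compactness hausG lcG scG (vaguely_bounded_subseq sinc vb).
exists (s \o r); first by move=> i j /rinc/sinc.
by split; [exists theta; exact: (vague_cvg_subseq rinc us)|exists eta].
Qed.

Lemma vague_cvg_unique u theta eta : vague_cvg u theta -> vague_cvg u eta -> theta = eta.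
Proof.
by move=> ut ue; apply/val_inj/funext => f; exact: normc_cvg_unique (ut f) (ue f).
Qed.

Lemma vague_cvg_linear u v theta eta (a b : R[i]) : vague_cvg u theta ->
  vague_cvg v eta -> vague_cvg (fun n => a *: u n + b *: v n) (a *: theta + b *: eta).
Proof.
move=> ut ve f.
change ((a *: (u n f : C) + b *: (v n f : C)) @[n --> \oo] -->
  (a *: (theta f : C) + b *: (eta f : C))).
by apply: cvgD; apply: cvgZr; [exact: ut|exact: ve].
Qed.

End subsequences.

Section eberlein.
Context {R : realType} {G : topologicalZmodType}.
Hypotheses (hausG : hausdorff_space G) (lcG : locally_compact [set: G]).
Hypothesis scG : @second_countable G.
Variable m : {measure set (borel G) -> \bar R}.
Hypothesis haar_m : is_haar m.
Local Notation cmeasure := (cmeasure R G).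
Implicit Types (mu nu sigma : cmeasure) (A B : nat -> set G) (a b : R[i]).

Lemma compact_closureN (D : set G) : precompact D -> compact (closure (-%R @` D)).
Proof.
rewrite precompactE => /compactN cD.
apply: subclosed_compact (cD) _; first exact: closed_closure.
have /closure_id -> := compact_closed hausG cD.
by apply: closureS => _ [x Dx <-]; exists x => //; exact: subset_closure.
Qed.

(* The conjugation [phi] is needed for [tilde]. *)
Lemma linear_combination (V : lmodType R[i]) (W : lmodType R[i]) (T : V -> W)
    (phi : R[i] -> R[i]) : phi (-1) = -1 ->
  (forall a x y, T (a *: x + y) = phi a *: T x + T y) ->
  forall a b x y, T (a *: x + b *: y) = phi a *: T x + phi b *: T y.
Proof.
move=> phiN TZ a b x y.
have T0 : T 0 = 0 by have := TZ (-1) 0 0; rewrite scaler0 addr0 phiN scaleN1r addNr.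
by rewrite TZ -[b *: y]addr0 TZ T0 addr0.
Qed.

Lemma eberlein_seq_linearl A a b mu nu sigma n : van_hove m A ->
  eberlein_seq m A (a *: mu + b *: nu) sigma n =
  a *: eberlein_seq m A mu sigma n + b *: eberlein_seq m A nu sigma n.
Proof.
move=> vhA; apply: (linear_combination (T := fun mu => eberlein_seq m A mu sigma n)
  (phi := id)) => // {}a {}mu {}nu.
have oA := van_hove_open vhA n.
have cA := compact_closureN (van_hove_precompact vhA n).
rewrite /eberlein_seq (restriction_linear hausG lcG)//.
rewrite (convolution_linearl hausG lcG _ _ _ cA (restriction_supported hausG lcG _ (openN oA))).
by rewrite scalerDr !scalerA mulrC.
Qed.

Lemma eberlein_seq_linearr A a b mu nu sigma n : van_hove m A ->
  eberlein_seq m A mu (a *: nu + b *: sigma) n =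
  a *: eberlein_seq m A mu nu n + b *: eberlein_seq m A mu sigma n.
Proof.
move=> vhA; apply: (linear_combination (T := fun nu => eberlein_seq m A mu nu n)
  (phi := id)) => // {}a {}nu {}sigma.
have oA := openN (van_hove_open vhA n).
have cA := compact_closureN (van_hove_precompact vhA n).
rewrite /eberlein_seq (restriction_linear hausG lcG)//.
rewrite (convolution_linearr hausG lcG _ _ cA (restriction_supported hausG lcG _ oA)
  (restriction_supported hausG lcG _ oA)).
by rewrite scalerDr !scalerA mulrC.
Qed.

Lemma eberlein_seq_tilde_linearr A a b mu nu sigma n : van_hove m A ->
  eberlein_seq m A mu (tilde (a *: nu + b *: sigma)) n =
  a^* *: eberlein_seq m A mu (tilde nu) n + b^* *: eberlein_seq m A mu (tilde sigma) n.
Proof.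
move=> vhA.
have -> : tilde (a *: nu + b *: sigma) = a^* *: tilde nu + b^* *: tilde sigma.
  apply: (linear_combination (T := @tilde R G) (phi := fun z : R[i] => z^*)).
    by rewrite rmorphN rmorph1.
  by move=> *; exact: tilde_linear.
exact: eberlein_seq_linearr.
Qed.

(** The normalisation cancels the factor |A_n| in the mass of [mu] on [A n], leaving a constant that
    depends on [K] only through [nu]. *)
Lemma eberlein_seq_bounded A mu nu : van_hove m A ->
  translation_bounded mu -> translation_bounded nu ->
  vaguely_bounded (eberlein_seq m A mu nu).
Proof.
move=> vhA tbmu tbnu K cK.
have [V V0 nuV] := translation_bounded_real tbnu cK.
have [W W0 muW] := van_hove_variation_le hausG lcG haar_m tbmu vhA.
(* Adding 1 makes the constant positive, as [vaguely_bounded] demands. *)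
exists (V * W + 1); first by rewrite ltr_wpDl// mulr_ge0.
apply: filterS muW => n muW f fK.
have M0 : 0 <= fine (m (A n)) by rewrite fine_ge0// measure_ge0.
have oA := van_hove_open vhA n.
have cA := compact_closureN (van_hove_precompact vhA n).
have := normc_convolution_restriction_le hausG lcG oA (openN oA) cA fK nuV muW.
set z := convolution _ _ f => zle.
change (normc ((fine (m (A n)))^-1%:C%C * z) <= (V * W + 1) * supnorm f).
rewrite normcM normc_real ger0_norm ?invr_ge0//.
apply: (@le_trans _ _ (V * W * supnorm f)); last first.
  by rewrite ler_wpM2r ?supnorm_ge0// lerDl.
(* If [fine (m (A n))] is 0, its inverse is 0 by convention and the left side vanishes. *)
move: M0; rewrite le_eqVlt => /predU1P[<-|M0].
  by rewrite invr0 mul0r !mulr_ge0 ?supnorm_ge0.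
rewrite ler_pdivrMl//; apply: (le_trans zle).
rewrite [leRHS](_ : _ = V * (W * fine (m (A n))) * supnorm f)//; ring.
Qed.

Lemma eberleinE A mu nu theta : vague_cvg (eberlein_seq m A mu nu) theta ->
  eberlein m A mu nu = theta.
Proof.
move=> At; rewrite /eberlein; case: xgetP => [eta _ Ae|/(_ theta)//].
exact: vague_cvg_unique Ae At.
Qed.

Lemma eberlein_subsequence A mu nu : van_hove m A ->
  translation_bounded mu -> translation_bounded nu ->
  exists2 B, subsequence B A & eberlein_exists m B mu nu.
Proof.
move=> vhA tbmu tbnu.
have [s sinc cvs] := vague_compactness hausG lcG scG (eberlein_seq_bounded vhA tbmu tbnu).
by exists (A \o s) => //; exists s.
Qed.

(** The common form of (c) to (f). Subsequences are extracted for the two summands; the combined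
    sequence then converges to the combined limit, and uniqueness of vague limits yields the
    formula. *)
Lemma eberlein_combination A a b (mu nu mu1 nu1 mu2 nu2 : cmeasure) : van_hove m A ->
  translation_bounded mu1 -> translation_bounded nu1 ->
  translation_bounded mu2 -> translation_bounded nu2 ->
  (forall n, eberlein_seq m A mu nu n =
    a *: eberlein_seq m A mu1 nu1 n + b *: eberlein_seq m A mu2 nu2 n) ->
  (exists2 B, subsequence B A & [/\ eberlein_exists m B mu nu,
     eberlein_exists m B mu1 nu1 & eberlein_exists m B mu2 nu2]) /\
  (forall B, subsequence B A -> eberlein_exists m B mu nu ->
     eberlein_exists m B mu1 nu1 -> eberlein_exists m B mu2 nu2 ->
     eberlein m B mu nu = a *: eberlein m B mu1 nu1 + b *: eberlein m B mu2 nu2).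
Proof.
move=> vhA tbmu1 tbnu1 tbmu2 tbnu2 comb.
have limit s theta eta : vague_cvg (eberlein_seq m (A \o s) mu1 nu1) theta ->
    vague_cvg (eberlein_seq m (A \o s) mu2 nu2) eta ->
    vague_cvg (eberlein_seq m (A \o s) mu nu) (a *: theta + b *: eta).
  move=> c1 c2.
  have -> : eberlein_seq m (A \o s) mu nu =
      (fun n => a *: eberlein_seq m (A \o s) mu1 nu1 n +
      b *: eberlein_seq m (A \o s) mu2 nu2 n).
    by apply/funext => n; exact: (comb (s n)).
  exact: vague_cvg_linear.
split.
  have [s sinc [[theta c1] [eta c2]]] := vague_compactness2 hausG lcG scG
    (eberlein_seq_bounded vhA tbmu1 tbnu1) (eberlein_seq_bounded vhA tbmu2 tbnu2).
  exists (A \o s); first by exists s.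
  have {}c1 : vague_cvg (eberlein_seq m (A \o s) mu1 nu1) theta := c1.
  have {}c2 : vague_cvg (eberlein_seq m (A \o s) mu2 nu2) eta := c2.
  split; [exact: ex_intro (limit _ _ _ c1 c2)|exact: ex_intro c1|exact: ex_intro c2].
move=> _ [s sinc ->] _ [theta c1] [eta c2].
rewrite (eberleinE c1) (eberleinE c2); exact: eberleinE (limit _ _ _ c1 c2).
Qed.

End eberlein.

Theorem theorem4p14 (R : realType) (G : topologicalZmodType)
    (hausG : hausdorff_space G)
    (lcG : locally_compact [set: G])
    (scG : @second_countable G)
    (m : {measure set (borel G) -> \bar R}) (haar_m : is_haar m)
    (mu nu sigma : cmeasure R G)
    (tb_mu : translation_bounded mu)
    (tb_nu : translation_bounded nu)
    (tb_sigma : translation_bounded sigma)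
    (a b : R[i])
    (A : nat -> set G) (vhA : van_hove m A) :
  (exists2 B, subsequence B A & twisted_exists m B mu nu)
  /\
  (exists2 B, subsequence B A & eberlein_exists m B mu nu)
  /\
  ((exists2 B, subsequence B A &
      [/\ twisted_exists m B (a *: mu + b *: nu) sigma,
          twisted_exists m B mu sigma
        & twisted_exists m B nu sigma]) /\
   (forall B, subsequence B A ->
      twisted_exists m B (a *: mu + b *: nu) sigma ->
      twisted_exists m B mu sigma ->
      twisted_exists m B nu sigma ->
      twisted m B (a *: mu + b *: nu) sigma =
        a *: twisted m B mu sigma + b *: twisted m B nu sigma))
  /\
  ((exists2 B, subsequence B A &
      [/\ twisted_exists m B mu (a *: nu + b *: sigma),
          twisted_exists m B mu nu
        & twisted_exists m B mu sigma]) /\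
   (forall B, subsequence B A ->
      twisted_exists m B mu (a *: nu + b *: sigma) ->
      twisted_exists m B mu nu ->
      twisted_exists m B mu sigma ->
      twisted m B mu (a *: nu + b *: sigma) =
        a^* *: twisted m B mu nu + b^* *: twisted m B mu sigma))
  /\
  ((exists2 B, subsequence B A &
      [/\ eberlein_exists m B (a *: mu + b *: nu) sigma,
          eberlein_exists m B mu sigma
        & eberlein_exists m B nu sigma]) /\
   (forall B, subsequence B A ->
      eberlein_exists m B (a *: mu + b *: nu) sigma ->
      eberlein_exists m B mu sigma ->
      eberlein_exists m B nu sigma ->
      eberlein m B (a *: mu + b *: nu) sigma =
        a *: eberlein m B mu sigma + b *: eberlein m B nu sigma))
  /\
  ((exists2 B, subsequence B A &
      [/\ eberlein_exists m B mu (a *: nu + b *: sigma),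
          eberlein_exists m B mu nu
        & eberlein_exists m B mu sigma]) /\
   (forall B, subsequence B A ->
      eberlein_exists m B mu (a *: nu + b *: sigma) ->
      eberlein_exists m B mu nu ->
      eberlein_exists m B mu sigma ->
      eberlein m B mu (a *: nu + b *: sigma) =
        a *: eberlein m B mu nu + b *: eberlein m B mu sigma)).
Proof.
have eb := eberlein_combination hausG lcG scG haar_m.
(* [twisted] is [eberlein] with the second measure replaced by its tilde, so these facts reduce the
   twisted parts to untwisted ones. *)
have tbt_nu := translation_bounded_tilde tb_nu.
have tbt_sigma := translation_bounded_tilde tb_sigma.
split; first exact: (eberlein_subsequence hausG lcG scG haar_m).
split; first exact: (eberlein_subsequence hausG lcG scG haar_m).
split; first by apply: eb => // n; exact: eberlein_seq_linearl.
(* Here the coefficients supplied to [eb] are the conjugates of [a] and [b], since [tilde] is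
   conjugate linear. *)
split; first by apply: eb => // n; exact: eberlein_seq_tilde_linearr.
split; first by apply: eb => // n; exact: eberlein_seq_linearl.
by apply: eb => // n; exact: eberlein_seq_linearr.
Qed.
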